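(* Let $m\ge0$ and let $\{X_i\}_{i\ge1}$ be a non-negative stationary $m$-dependent sequence with $\mu:=\mathbb{E}[X_1]>0$, $\sigma^2:=\mathrm{Var}(X_1)>0$, $\mathbb{E}|X_1|^3<\infty$, $a_j:=\mathrm{Cov}(X_1,X_{1+j})$ for $j=1,\dots,m$, and $\sigma^2+2\sum_{j=1}^m a_j>0$. Let $Y_1,Y_2,\dots$ be i.i.d. non-negative integer-valued random variables with $\nu:=\mathbb{E}[Y_1]>0$, $\tau^2:=\mathrm{Var}(Y_1)>0$, $\mathbb{E}|Y_1|^3<\infty$, independent of $\{X_i\}$, and let $N_n=\sum_{i=1}^nY_i$. Then $$\frac{\sum_{i=1}^{N_n}X_i-n\mu\nu}{\sqrt{n\big(\nu\sigma^2+2\nu\sum_{j=1}^m a_j+\tau^2\mu^2\big)}}\longrightarrow N(0,1)\quad\text{in distribution as } n\to\infty.$$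
   Context: Stationary: for all $k$, shifts $s\ge0$ and indices $i_1,\dots,i_k$, $(X_{i_1+s},\dots,X_{i_k+s})$ has the same joint law as $(X_{i_1},\dots,X_{i_k})$. $m$-dependent: with $\rho(A,B)=\inf\{|i-j|:i\in A,j\in B\}$ for $A,B\subset\mathbb{N}$, the families $\{X_i:i\in A\}$ and $\{X_j:j\in B\}$ are independent whenever $\rho(A,B)>m$. An empty sum equals $0$. $N(0,1)$ denotes a standard normal random variable. *)

(* Defs.v *)
From HB Require Import structures.
From mathcomp Require Import all_boot all_order all_algebra.
From mathcomp Require Import all_classical all_reals all_analysis.
Set Implicit Arguments. Unset Strict Implicit. Unset Printing Implicit Defensive.
Import Order.TTheory GRing.Theory Num.Theory.
Import numFieldTopology.Exports numFieldNormedType.Exports.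
Local Open Scope classical_set_scope.
Local Open Scope ring_scope.

(* Independence of the families {X_i : i in A} and {Y_j : j in B}:
   product rule for all finite-dimensional cylinder events
   (equivalent to independence of the generated sigma-algebras). *)
Definition indep_families d (T : measurableType d) (R : realType)
  (P : probability T R) (I J : Type) d1 d2
  (U1 : measurableType d1) (U2 : measurableType d2)
  (X : I -> T -> U1) (A : set I) (Y : J -> T -> U2) (B : set J) : Prop :=
  forall (F : set I) (G : set J) (C : I -> set U1) (D : J -> set U2),
    finite_set F -> finite_set G -> F `<=` A -> G `<=` B ->
    (forall i, measurable (C i)) -> (forall j, measurable (D j)) ->
    P ((\bigcap_(i in F) (X i @^-1` C i)) `&`
       (\bigcap_(j in G) (Y j @^-1` D j)))
    = (P (\bigcap_(i in F) (X i @^-1` C i)) *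
       P (\bigcap_(j in G) (Y j @^-1` D j)))%E.

(* Stationarity: the joint laws of (X_{i_1+s},...,X_{i_k+s}) and
   (X_{i_1},...,X_{i_k}) agree (checked on measurable rectangles,
   which determine the joint law). *)
Definition stationary d (T : measurableType d) (R : realType)
  (P : probability T R) (X : nat -> T -> R) : Prop :=
  forall (k sh : nat) (idx : nat -> nat) (C : nat -> set R),
    (forall l, measurable (C l)) ->
    P (\bigcap_(l in `I_k) (X (idx l + sh) @^-1` C l))
    = P (\bigcap_(l in `I_k) (X (idx l) @^-1` C l)).

Definition m_dependent d (T : measurableType d) (R : realType)
  (P : probability T R) (m : nat) (X : nat -> T -> R) : Prop :=
  forall A B : set nat,
    (forall i j, A i -> B j -> (m < i - j)%N || (m < j - i)%N) ->
    indep_families P X A X B.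

Definition mutually_indep d (T : measurableType d) (R : realType)
  (P : probability T R) d1 (U : measurableType d1) (Y : nat -> T -> U) : Prop :=
  forall (s : seq nat) (C : nat -> set U), uniq s ->
    (forall i, measurable (C i)) ->
    P (\bigcap_(i in [set` s]) (Y i @^-1` C i))
    = (\prod_(i <- s) P (Y i @^-1` C i))%E.

Definition ident_distr d (T : measurableType d) (R : realType)
  (P : probability T R) d1 (U : measurableType d1) (Y : nat -> T -> U) : Prop :=
  forall i (C : set U), measurable C -> P (Y i @^-1` C) = P (Y 0%N @^-1` C).

(* Convergence in distribution to the standard normal law N(0,1):
   pointwise convergence of the distribution functions (the limit cdf is
   continuous everywhere). *)
Definition cvg_dist_std_normal d (T : measurableType d) (R : realType)
  (P : probability T R) (Z : nat -> T -> R) : Prop :=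
  forall x : R,
    (fun n => fine (P (Z n @^-1` `]-oo, x]))) @ \oo
      --> fine (normal_prob 0 1 `]-oo, x]).

(* Main.v *)
(* Let S_l be the sum of the first l centred X_i, and K the integer part of n nu.
   Since N_n is independent of the X_i, conditioning on N_n gives
   E (S_{N_n} - S_K)^2 <= C E |N_n - K| = O(sqrt n), so after normalisation the
   statistic may be replaced by U = b (S_K + mu (N_n - n nu)) with
   b = 1 / sqrt(n V). This is a sum of locally dependent centred variables, with
   variance tending to 1, and Stein's method gives E (f'(U) - U f(U)) -> 0 for
   every bounded f with f' bounded and Lipschitz. A Lipschitz g with compact
   support and Gaussian mean zero is of the form f' - x f with such an f;
   subtracting from a test function a multiple of a wide cutoff makes its Gaussian
   mean zero, and by tightness the cutoff has expectation close to 1. *)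
Require Import Defs.
From HB Require Import structures.
From mathcomp Require Import all_boot all_order all_algebra.
From mathcomp Require Import all_classical all_reals all_analysis measurable_realfun.
From mathcomp Require Import ring lra zify.
Import Order.TTheory GRing.Theory Num.Theory.
Import numFieldTopology.Exports numFieldNormedType.Exports.
Local Open Scope classical_set_scope.
Local Open Scope ring_scope.
Set Implicit Arguments. Unset Strict Implicit. Unset Printing Implicit Defensive.

(** * Independence *)

(** The obstacle is the random upper limit: [N_n] involves every [Y_k], so the terms of the random
    sum are not locally dependent. Replacing [N_n] by the deterministic [K] restores a fixed index
    set, and costs a mean square of order [b^2 * sqrt n], that is [n^(-1/2)]. What remains is a sum
    of [K + n] members of one family: [X_i - mu], whose neighbours are the indices within [m], and
    [mu * (Y_k - nu)], which has no neighbour but itself. The two kinds are uncorrelated, so the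
    variances add: the first block contributes about [n * nu] times the long-run variance of the
    [X_i], the second exactly [n * mu^2 * tau^2]. Their sum is [n * V] up to a bounded error, which
    is the origin of the normalisation. Third moments serve only to bound the Taylor remainder in
    Stein's argument, of total order [b^3 * (K + n)], again [n^(-1/2)]. Restricting to compactly
    supported test functions makes the Stein solution compactly supported as well, so that no
    Gaussian tail estimate enters; the price is the mean-zero constraint, paid for with the
    cutoff. *)

Definition mfun_pack d d' (T : measurableType d) (U : measurableType d')
    (F : T -> U) (mF : measurable_fun setT F) : {mfun T >-> U} :=
  MeasurableFun.Pack (MeasurableFun.Class (isMeasurableFun.Build _ _ _ _ _ mF)).

Section independence.
Context d (T : measurableType d) (R : realType) (P : probability T R).

Definition indep_sets (G H : set (set T)) :=
  forall A B, G A -> H B -> P (A `&` B) = (P A * P B)%E.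

Lemma indep_setsC G H : indep_sets G H -> indep_sets H G.
Proof. by move=> GH A B HA GB; rewrite setIC muleC; exact: GH. Qed.

(** For fixed [B] in [H], the events [A] obeying the product rule form a Dynkin system containing
    the pi-system [G]. No stability of [H] is assumed, so the argument can be applied to each side
    in turn. *)
Lemma indep_sets_sigmal G H : setI_closed G -> G `<=` measurable ->
  H `<=` measurable -> indep_sets G H -> indep_sets <<s G >> H.
Proof.
move=> GI mG mH GH A B sA HB; have mB := mH _ HB.
suff: <<s G >> `<=` [set A | measurable A /\ P (A `&` B) = (P A * P B)%E].
  by move=> /(_ _ sA)[].
apply: lambda_system_subset => //; last by move=> C GC; split; [exact: mG|exact: GH].
apply/dynkin_lambda_system; split.
- by split=> //; rewrite setTI probability_setT mul1e.
- move=> C [mC PC]; split; first exact: measurableC.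
  rewrite setIC -setDE measureD// ?(le_lt_trans (probability_le1 P mB)) ?ltry//.
  transitivity (P B - P C * P B)%E; first by congr (_ - _)%E; rewrite setIC.
  rewrite probability_setC// muleBl ?mul1e//.
  by rewrite fin_num_measure.
- move=> F tF HF; have mF k : measurable (F k) by case: (HF k).
  split; first exact: bigcup_measurable.
  rewrite setI_bigcupl measure_bigcup//=; last 2 first.
    by move=> i _; exact: measurableI.
    exact: trivIset_setIr.
  have PB : P B \is a fin_num by rewrite fin_num_measure.
  rewrite measure_bigcup// muleC -(fineK PB) -nneseriesZl//=.
  by apply: eq_eseriesr => i _; rewrite (fineK PB) muleC; case: (HF i).
Qed.

Lemma indep_sets_sigma G H : setI_closed G -> setI_closed H ->
  G `<=` measurable -> H `<=` measurable ->
  indep_sets G H -> indep_sets <<s G >> <<s H >>.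
Proof.
move=> GI HI mG mH GH.
have sG : <<s G >> `<=` measurable by apply: smallest_sub => //; exact: sigma_algebra_measurable.
by apply/indep_setsC/indep_sets_sigmal => //; apply/indep_setsC/indep_sets_sigmal.
Qed.

Definition indep_rv (F G : T -> R) := forall C D, measurable C -> measurable D ->
  P (F @^-1` C `&` G @^-1` D) = (P (F @^-1` C) * P (G @^-1` D))%E.

Section product.
Variables F G : T -> R.
Hypotheses (mF : measurable_fun setT F) (mG : measurable_fun setT G).
Hypothesis FG : indep_rv F G.
Hypotheses (iF : P.-integrable setT (EFin \o F)) (iG : P.-integrable setT (EFin \o G)).

Let Fm : {mfun T >-> R} := mfun_pack mF.
Let Gm : {mfun T >-> R} := mfun_pack mG.
Let FGp w := (F w, G w).
Let mFG : measurable_fun setT FGp.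
Proof. exact: measurable_fun_pair. Qed.
Let FGm : {mfun T >-> (R * R)%type} := mfun_pack mFG.

(** A product measure is determined by its values on rectangles, where the equality is [FG]. *)
Let law A : measurable A -> (distribution P Fm \x distribution P Gm)%E A = distribution P FGm A.
Proof. by apply: product_measure_unique => C D mC mD; exact: FG. Qed.

Let mmul : measurable_fun setT (fun z : R * R => (z.1 * z.2)%:E).
Proof. by apply/measurable_EFinP; apply: measurable_funM. Qed.

(** Tonelli: the iterated integral of [|x * y|] factors into the two first absolute moments. Hence
    no second moment is required. *)
Let mul_law : (distribution P Fm \x distribution P Gm)%E.-integrable setT
  (fun z : R * R => (z.1 * z.2)%:E).
Proof.
apply/integrable12ltyP => //=.
have iaG : (\int[distribution P Gm]_y `|y%:E| < +oo)%E.
  rewrite ge0_integral_distribution//=; first by case/integrableP : iG.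
  by do 2 apply: measurableT_comp => //.
have iaF : (\int[distribution P Fm]_y `|y%:E| < +oo)%E.
  rewrite ge0_integral_distribution//=; first by case/integrableP : iF.
  by do 2 apply: measurableT_comp => //.
under eq_integral => x _.
  under eq_integral do rewrite normrM EFinM.
  rewrite ge0_integralZl//; last by do 2 apply: measurableT_comp => //.
  over.
rewrite ge0_integralZr//; last first.
- exact: integral_ge0.
- by do 2 apply: measurableT_comp => //.
by rewrite lte_mul_pinfty ?integral_ge0// ge0_fin_numE ?integral_ge0.
Qed.

Lemma indep_rv_integrableM : P.-integrable setT (fun w => (F w * G w)%:E).
Proof.
case/integrableP : mul_law => _ h; apply/integrableP; split.
  by apply/measurable_EFinP; exact: measurable_funM.
move: h; rewrite (eq_measure_integral (distribution P FGm)); last first.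
  by move=> A mA _; exact: law.
by rewrite ge0_integral_distribution//; exact: measurableT_comp.
Qed.

Lemma indep_rv_expectM : \int[P]_w (F w * G w) = \int[P]_w F w * \int[P]_w G w.
Proof.
have -> : \int[P]_w (F w * G w) =
    fine (\int[distribution P FGm]_z ((z.1 * z.2)%:E))%E.
  by rewrite integral_distribution//; exact: indep_rv_integrableM.
rewrite (eq_measure_integral (distribution P Fm \x distribution P Gm)%E); last first.
  by move=> A mA _; exact/esym/law.
rewrite -integral12_prod_meas1//= /fubini_F /=.
have iG' : (distribution P Gm).-integrable setT (EFin : R -> \bar R).
  by apply: integrable_pushforward.
have iF' : (distribution P Fm).-integrable setT (EFin : R -> \bar R).
  by apply: integrable_pushforward.
under eq_integral => x _.
  under eq_integral do rewrite EFinM.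
  rewrite integralZl//; over.
have /fineK <- : (\int[distribution P Gm]_y y%:E)%E \is a fin_num by exact: integrable_fin_num.
rewrite integralZr// fineM//; last exact: integrable_fin_num.
by rewrite !integral_distribution.
Qed.

End product.

Section cylinders.
Context (I : eqType) (Z : I -> T -> R).
Hypothesis mZ : forall i, measurable_fun setT (Z i).

(** A pi-system generating the sigma-algebra of the [Z i] with [i] in [F]. Being a function of these
    variables is expressed below as measurability on [g_sigma_algebraType (cyl F)]. *)
Definition cyl (F : set I) : set (set T) :=
  [set E | exists2 C : I -> set R, (forall i, measurable (C i)) &
                   E = \bigcap_(i in F) (Z i @^-1` C i)].

Lemma setI_closed_cyl F : setI_closed (cyl F).
Proof.
move=> _ _ [C mC ->] [D mD ->]; exists (fun i => C i `&` D i).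
  by move=> i; exact: measurableI.
by rewrite -bigcapI; apply: eq_bigcapr => i _; rewrite preimage_setI.
Qed.

Lemma cyl_measurable F : finite_set F -> cyl F `<=` measurable.
Proof.
move=> fF _ [C mC ->]; apply: fin_bigcap_measurable => // i _.
by rewrite -[X in measurable X]setTI; exact: mZ.
Qed.

Lemma measurable_cyl F i : F i ->
  measurable_fun (setT : set (g_sigma_algebraType (cyl F))) (Z i).
Proof.
move=> Fi _ C mC; rewrite setTI; apply: sub_sigma_algebra.
exists (fun j => if j == i then C else setT); first by move=> j; case: ifP.
apply/seteqP; split=> [w Cw j Fj /=|w /(_ i Fi)/=]; last by rewrite eqxx.
by case: eqP => [->|].
Qed.

(** All independence used later passes through this lemma: the product rule is checked on cylinders
    only, and [f], [g] may be any functions of the two groups of variables. *)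
Lemma indep_rv_cyl F G (f g : T -> R) : finite_set F -> finite_set G ->
  indep_sets (cyl F) (cyl G) ->
  measurable_fun (setT : set (g_sigma_algebraType (cyl F))) f ->
  measurable_fun (setT : set (g_sigma_algebraType (cyl G))) g ->
  indep_rv f g.
Proof.
move=> fF fG FG mf mg C D mC mD.
have := indep_sets_sigma (@setI_closed_cyl F) (@setI_closed_cyl G)
  (cyl_measurable fF) (cyl_measurable fG) FG.
apply; first by rewrite -[X in <<s _ >> X]setTI; exact: mf.
by rewrite -[X in <<s _ >> X]setTI; exact: mg.
Qed.

End cylinders.
End independence.

(** * Merging the two sequences into one family *)

Section mixed.
Context d (T : measurableType d) (R : realType) (P : probability T R).

Lemma bigcap_preimage_glue (I : eqType) (U : Type) (f : I -> T -> U) (F G : set I)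
    (C D : I -> set U) : F `&` G = set0 ->
  (\bigcap_(i in F) f i @^-1` C i) `&` (\bigcap_(i in G) f i @^-1` D i) =
  \bigcap_(i in F `|` G) f i @^-1` (if i \in F then C i else D i).
Proof.
move=> FG; rewrite bigcap_setU; congr (_ `&` _); apply: eq_bigcapr => i.
- by move=> Fi; rewrite mem_set.
- by move=> Gi; rewrite memNset// => Fi; have : (F `&` G) i by []; rewrite FG.
Qed.

Lemma mutually_indep_disjoint d1 (U : measurableType d1) (Y : nat -> T -> U)
    (F G : set nat) (C D : nat -> set U) : mutually_indep P Y ->
  finite_set F -> finite_set G -> F `&` G = set0 ->
  (forall i, measurable (C i)) -> (forall i, measurable (D i)) ->
  P ((\bigcap_(i in F) Y i @^-1` C i) `&` (\bigcap_(i in G) Y i @^-1` D i)) =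
  (P (\bigcap_(i in F) Y i @^-1` C i) * P (\bigcap_(i in G) Y i @^-1` D i))%E.
Proof.
move=> Yi /finite_seqP[s Fs] /finite_seqP[t Gt] FG mC mD.
(* [mutually_indep] speaks of lists without repetition; [F] and [G] being disjoint, the
   concatenation of the two cleaned lists is again one. *)
have {Fs}Fs : F = [set` undup s] by rewrite Fs; apply/seteqP; split=> x /=; rewrite mem_undup.
have {Gt}Gt : G = [set` undup t] by rewrite Gt; apply/seteqP; split=> x /=; rewrite mem_undup.
rewrite bigcap_preimage_glue//.
have mE i : measurable (if i \in F then C i else D i) by case: ifP.
have -> : F `|` G = [set` undup s ++ undup t].
  rewrite Fs Gt; apply/seteqP; split=> x /=; rewrite mem_cat.
    by case=> ->; rewrite ?orbT.
  by case/orP; [left|right].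
rewrite (Yi _ _ _ mE); last first.
  rewrite cat_uniq !undup_uniq andbT/=; apply/hasPn => x tx; apply/negP => sx.
  have : (F `&` G) x by rewrite Fs Gt.
  by rewrite FG.
have -> : P (\bigcap_(i in F) Y i @^-1` C i) = (\prod_(i <- undup s) P (Y i @^-1` C i))%E.
  by rewrite Fs Yi ?undup_uniq.
have -> : P (\bigcap_(i in G) Y i @^-1` D i) = (\prod_(i <- undup t) P (Y i @^-1` D i))%E.
  by rewrite Gt Yi ?undup_uniq.
rewrite big_cat/=.
congr (_ * _)%E; apply: eq_big_seq => i.
- by move=> si; rewrite mem_set// Fs.
- move=> ti; rewrite memNset// => Fi.
  by have : (F `&` G) i by [split=> //; rewrite Gt]; rewrite FG.
Qed.

Context (X : nat -> T -> R) (Y : nat -> T -> nat) (m : nat) (u : R -> R) (v : nat -> R).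
Hypotheses (mu : measurable_fun setT u) (Xm : m_dependent P m X).
Hypotheses (Yi : mutually_indep P Y) (XY : indep_families P X setT Y setT).

(* The two sequences are merged into one family indexed by [nat + nat]: [inl i]
   is the index of a function of [X i], [inr k] of a function of [Y k]. *)
Definition mixed (s : nat + nat) (w : T) : R :=
  match s with inl i => u (X i w) | inr k => v (Y k w) end.

Lemma bigcap_mixed (F : set (nat + nat)) (C : nat + nat -> set R) :
  \bigcap_(s in F) mixed s @^-1` C s =
  (\bigcap_(i in inl @^-1` F) X i @^-1` (u @^-1` C (inl i))) `&`
  (\bigcap_(k in inr @^-1` F) Y k @^-1` (v @^-1` C (inr k))).
Proof.
apply/seteqP; split=> [w Fw|w [Xw Yw] [i|k] Fi]; last 2 first.
- exact: Xw.
- exact: Yw.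
by split=> i Fi; exact: (Fw _ Fi).
Qed.

(** Each event is an [X]-part intersected with a [Y]-part. The four parts are regrouped by sequence
    and glued into one cylinder per sequence, so that [XY] separates [X] from [Y]; then
    [m]-dependence splits the [X]-cylinder and mutual independence the [Y]-cylinder. *)
Lemma indep_sets_mixed F G : finite_set F -> finite_set G ->
  (forall i j, F (inl i) -> G (inl j) -> (m < i - j)%N || (m < j - i)%N) ->
  (forall k, F (inr k) -> ~ G (inr k)) ->
  indep_sets P (cyl mixed F) (cyl mixed G).
Proof.
move=> fF fG FGX FGY _ _ [C mC ->] [D mD ->].
have mCl i : measurable (u @^-1` C (inl i)) by rewrite -[X in measurable X]setTI; exact: mu.
have mDl i : measurable (u @^-1` D (inl i)) by rewrite -[X in measurable X]setTI; exact: mu.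
have fin_l (H : set (nat + nat)) : finite_set H -> finite_set (inl @^-1` H).
  by move=> fH; apply: finite_preimage => // ? ? _ _ [].
have fin_r (H : set (nat + nat)) : finite_set H -> finite_set (inr @^-1` H).
  by move=> fH; apply: finite_preimage => // ? ? _ _ [].
have FG0 : (inl @^-1` F) `&` (inl @^-1` G) = set0.
  by apply/seteqP; split=> // i [/FGX h /h]; rewrite subnn.
have FG1 : (inr @^-1` F) `&` (inr @^-1` G) = set0.
  by apply/seteqP; split=> // i [/FGY].
rewrite !bigcap_mixed setIACA.
rewrite [X in P (X `&` _)]bigcap_preimage_glue//.
rewrite [X in P (_ `&` X)]bigcap_preimage_glue//.
have split_P H (E : nat -> set R) K (E' : nat -> set nat) :
    finite_set H -> finite_set K -> (forall i, measurable (E i)) ->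
  P ((\bigcap_(i in H) X i @^-1` E i) `&` (\bigcap_(i in K) Y i @^-1` E' i)) =
  (P (\bigcap_(i in H) X i @^-1` E i) * P (\bigcap_(i in K) Y i @^-1` E' i))%E.
  by move=> fH fK mE; apply: XY.
have [fFl fGl fFr fGr] : [/\ finite_set (@inl nat nat @^-1` F), finite_set (@inl nat nat @^-1` G),
    finite_set (@inr nat nat @^-1` F) & finite_set (@inr nat nat @^-1` G)].
  by split; [exact: fin_l|exact: fin_l|exact: fin_r|exact: fin_r].
have mCD i : measurable (if i \in inl @^-1` F then u @^-1` C (inl i) else u @^-1` D (inl i)).
  by case: ifP.
rewrite (split_P _ _ (inr @^-1` F))// (split_P _ _ (inr @^-1` G))//.
rewrite split_P//; [|by rewrite finite_setU..].
rewrite -!bigcap_preimage_glue//.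
rewrite (Xm FGX)//.
rewrite (mutually_indep_disjoint Yi)//.
by rewrite muleACA.
Qed.

End mixed.

(** * Expectations and moments *)

Section real_functions.
Context (R : realType).

Lemma lipschitz_continuous (f : R -> R) (L : R) :
  (forall x y, `|f x - f y| <= L * `|x - y|) -> continuous f.
Proof.
move=> fL x; apply/cvgrPdist_lt => e e0.
have L0 : 0 < `|L| + 1 by rewrite ltr_pwDr.
near=> y; apply: (le_lt_trans (fL _ _)).
apply: (@le_lt_trans _ _ ((`|L| + 1) * `|x - y|)).
  by rewrite ler_wpM2r// (le_trans (ler_norm L))// lerDl.
rewrite mulrC -ltr_pdivlMr//.
near: y; apply: (@cvgr_dist_lt _ _ _ (nbhs x) _ id x); first exact: cvg_id.
by rewrite divr_gt0.
Unshelve. all: by end_near. Qed.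

Lemma lipschitz_measurable (f : R -> R) (L : R) :
  (forall x y, `|f x - f y| <= L * `|x - y|) -> measurable_fun setT f.
Proof. by move=> /lipschitz_continuous; exact: continuous_measurable_fun. Qed.

Lemma derive_mean_value (f f' : R -> R) : (forall x : R, is_derive x 1 f (f' x)) ->
  forall x y, exists2 c, `|c - x| <= `|x - y| & f x - f y = f' c * (x - y).
Proof.
move=> ff' x y.
have cf : continuous f.
  move=> z; apply: differentiable_continuous; apply/derivable1_diffP.
  exact: (@ex_derive _ _ _ _ _ _ _ (ff' z)).
have [yx|/ltW xy] := leP y x.
  have [c + e] := @MVT_segment R f f' y x yx (fun z _ => ff' z) (continuous_subspaceT cf).
  rewrite in_itv/= => /andP[yc cx]; exists c => //.
  by rewrite ler0_norm ?subr_le0// ger0_norm ?subr_ge0//; lra.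
have [c + e] := @MVT_segment R f f' x y xy (fun z _ => ff' z) (continuous_subspaceT cf).
rewrite in_itv/= => /andP[xc cy]; exists c; last first.
  by rewrite -opprB e -mulrN opprB.
by rewrite ger0_norm ?subr_ge0// ler0_norm ?subr_le0//; lra.
Qed.

Lemma derive_bounded_lipschitz (f f' : R -> R) (M : R) :
  (forall x : R, is_derive x 1 f (f' x)) -> (forall x, `|f' x| <= M) ->
  forall x y, `|f x - f y| <= M * `|x - y|.
Proof.
move=> ff' f'M x y; have [c _ ->] := derive_mean_value ff' x y.
by rewrite normrM ler_wpM2r.
Qed.

(** The slope is taken at a third point [t]: in Stein's argument it must be evaluated at a sum
    independent of the increment, and this is neither of the two endpoints. *)
Lemma derive_taylor1 (f f' : R -> R) (L : R) :
  (forall x : R, is_derive x 1 f (f' x)) -> 0 <= L ->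
  (forall x y, `|f' x - f' y| <= L * `|x - y|) ->
  forall x y t, `|f x - f y - (x - y) * f' t| <=
    `|x - y| * (L * (`|x - y| + `|x - t|)).
Proof.
move=> ff' L0 f'L x y t; have [c cx ->] := derive_mean_value ff' x y.
rewrite (mulrC (f' c)) -mulrBr normrM ler_wpM2l// (le_trans (f'L _ _))//.
rewrite ler_wpM2l// (le_trans (ler_distD x _ _))//.
by rewrite lerD2r.
Qed.

(** Measurability is asked only of the terms satisfying [Q]. This matters when [T] carries the
    sigma-algebra of a group of variables, for which the other terms need not be measurable. *)
Lemma measurable_sum_cond d (T : measurableType d) (I : Type) (s : seq I)
    (Q : pred I) (f : I -> T -> R) : (forall i, Q i -> measurable_fun setT (f i)) ->
  measurable_fun setT (fun w => \sum_(i <- s | Q i) f i w).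
Proof.
move=> mf; rewrite (_ : (fun _ => _) = fun w => \sum_(i <- s) if Q i then f i w else 0).
  apply: measurable_sum => i; case Qi: (Q i); last exact: measurable_cst.
  exact: mf.
by apply/funext => w; rewrite big_mkcond.
Qed.

End real_functions.

Section expectation.
Context d (T : measurableType d) (R : realType) (P : probability T R).

Local Notation L1 f := (P.-integrable setT (EFin \o f)).

Lemma L1_measurable (f : T -> R) : L1 f -> measurable_fun setT f.
Proof. by move=> /measurable_int/measurable_EFinP. Qed.

Lemma L1_sum (I : Type) (s : seq I) (Q : pred I) (f : I -> T -> R) :
  (forall i, L1 (f i)) -> L1 (fun w => \sum_(i <- s | Q i) f i w).
Proof.
move=> Lf; rewrite (_ : EFin \o _ = fun w => (\sum_(i <- s | Q i) (f i w)%:E)%E); last first.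
  by apply/funext => w /=; rewrite sumEFin.
by apply: integrable_sum => // i _; exact: Lf.
Qed.

Lemma Rintegral_sum (I : Type) (s : seq I) (Q : pred I) (f : I -> T -> R) :
  (forall i, L1 (f i)) ->
  \int[P]_w (\sum_(i <- s | Q i) f i w) = \sum_(i <- s | Q i) \int[P]_w f i w.
Proof.
move=> Lf; elim: s => [|i s IH].
  by under eq_Rintegral do rewrite big_nil; rewrite big_nil Rintegral_cst// mul0r.
under eq_Rintegral do rewrite big_cons.
rewrite big_cons; case: ifP => // _; rewrite RintegralD ?IH//; exact: L1_sum.
Qed.

Lemma L1_dominated (f g : T -> R) : measurable_fun setT f ->
  (forall w, `|f w| <= g w) -> L1 g -> L1 f.
Proof.
move=> mf fg; apply: le_integrable => //; first exact/measurable_EFinP.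
by move=> w _ /=; rewrite lee_fin (le_trans (fg w))// ler_norm.
Qed.

Lemma L1_cst (c : R) : L1 (fun=> c).
Proof. exact: finite_measure_integrable_cst. Qed.

Lemma L1D (f g : T -> R) : L1 f -> L1 g -> L1 (fun w => f w + g w).
Proof. by move=> Lf Lg; exact: (integrableD measurableT Lf Lg). Qed.

Lemma L1Z (c : R) (f : T -> R) : L1 f -> L1 (fun w => c * f w).
Proof. by move=> Lf; exact: (integrableZl measurableT c Lf). Qed.

Lemma L1B (f g : T -> R) : L1 f -> L1 g -> L1 (fun w => f w - g w).
Proof. by move=> Lf Lg; exact: (integrableB measurableT Lf Lg). Qed.

Lemma le_expect (f g : T -> R) : L1 f -> L1 g -> (forall w, f w <= g w) ->
  \int[P]_w f w <= \int[P]_w g w.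
Proof. by move=> Lf Lg fg; apply: le_Rintegral. Qed.

Lemma expect_cst (c : R) : \int[P]_w c = c.
Proof.
rewrite Rintegral_cst// -[RHS]mulr1; congr (_ * _).
by rewrite [X in fine X](_ : _ = 1%E)//; exact: probability_setT.
Qed.

End expectation.

(** * Lower moments bounded by third absolute moments *)

Section cubes.
Context d (T : measurableType d) (R : realType) (P : probability T R).

Local Notation L1 f := (P.-integrable setT (EFin \o f)).
Local Notation L3 f := (L1 (fun w => `|f w| ^+ 3)).

(** The product is at most the cube of the largest factor. This crude bound stands in for Hölder's
    inequality; with one or two factors set to [1] it controls products of two variables and first
    moments, hence the summands [1] and [2] in the bounds below. *)
Lemma mulr3_le_cubes (x y z : R) : 0 <= x -> 0 <= y -> 0 <= z ->
  x * y * z <= x ^+ 3 + y ^+ 3 + z ^+ 3.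
Proof.
move=> x0 y0 z0; pose M := Num.max x (Num.max y z).
have xM : x <= M by rewrite /M !le_max lexx.
have yM : y <= M by rewrite /M !le_max lexx orbT.
have zM : z <= M by rewrite /M !le_max lexx !orbT.
have h : x * y * z <= M ^+ 3.
  by rewrite !exprS expr0 mulr1 mulrA !ler_pM// mulr_ge0.
apply: (le_trans h).
have [x3 y3 z3] : [/\ 0 <= x ^+ 3, 0 <= y ^+ 3 & 0 <= z ^+ 3] by rewrite !exprn_ge0.
by rewrite /M; have [_|_] := leP x (Num.max y z); [have [_|_] := leP y z|]; lra.
Qed.

Lemma L1_mulr_bounded (f g : T -> R) (M : R) : L1 f -> measurable_fun setT g ->
  (forall w, `|g w| <= M) -> L1 (fun w => f w * g w).
Proof.
move=> Lf mg gM; have mf := L1_measurable Lf.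
apply: (@L1_dominated _ _ _ _ _ (fun w => M * `|f w|)).
- exact: measurable_funM.
- by move=> w; rewrite normrM mulrC ler_wpM2r.
- by apply: L1Z; exact: integrable_norm.
Qed.

Lemma L1_bounded (g : T -> R) (M : R) : measurable_fun setT g ->
  (forall w, `|g w| <= M) -> L1 g.
Proof. by move=> mg gM; apply: (L1_dominated mg gM); exact: L1_cst. Qed.

Lemma norm_expect_le (f : T -> R) : L1 f -> `|\int[P]_w f w| <= \int[P]_w `|f w|.
Proof. by move=> Lf; exact: le_normr_Rintegral. Qed.

Lemma norm_expect_le_bound (f g : T -> R) : L1 f -> L1 g ->
  (forall w, `|f w| <= g w) -> `|\int[P]_w f w| <= \int[P]_w g w.
Proof.
move=> Lf Lg fg; apply: (le_trans (norm_expect_le Lf)); apply: le_expect => //.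
exact: integrable_norm.
Qed.

Variables f g h : T -> R.
Hypotheses (mf : measurable_fun setT f) (mg : measurable_fun setT g)
  (mh : measurable_fun setT h).
Hypotheses (Lf : L3 f) (Lg : L3 g) (Lh : L3 h).

Lemma L3_mul3 : L1 (fun w => `|f w * g w * h w|).
Proof.
apply: (@L1_dominated _ _ _ _ _ (fun w => `|f w| ^+ 3 + `|g w| ^+ 3 + `|h w| ^+ 3)).
- by apply: measurableT_comp => //; apply: measurable_funM => //; exact: measurable_funM.
- by move=> w; rewrite normr_id !normrM; apply: mulr3_le_cubes.
- by do 2?[apply: L1D].
Qed.

Lemma expect_mul3_le : \int[P]_w `|f w * g w * h w| <=
  \int[P]_w `|f w| ^+ 3 + \int[P]_w `|g w| ^+ 3 + \int[P]_w `|h w| ^+ 3.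
Proof.
rewrite -!RintegralD//; last exact: L1D.
apply: le_expect; [exact: L3_mul3|by do 2?[apply: L1D]|].
by move=> w; rewrite !normrM; apply: mulr3_le_cubes.
Qed.

End cubes.

Section squares.
Context d (T : measurableType d) (R : realType) (P : probability T R).

Local Notation L1 f := (P.-integrable setT (EFin \o f)).
Local Notation L3 f := (L1 (fun w => `|f w| ^+ 3)).
Variables f g : T -> R.
Hypotheses (mf : measurable_fun setT f) (mg : measurable_fun setT g).
Hypotheses (Lf : L3 f) (Lg : L3 g).

Let L31 : L3 (fun=> 1).
Proof. exact: L1_cst. Qed.

Let E31 : \int[P]_w `|1| ^+ 3 = 1 :> R.
Proof. by rewrite expect_cst normr1 expr1n. Qed.

Lemma L3_mul : L1 (fun w => f w * g w).
Proof.
apply: (@L1_dominated _ _ _ _ _ (fun w => `|f w * g w * 1|)).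
- exact: measurable_funM.
- by move=> w; rewrite mulr1.
- exact: L3_mul3.
Qed.

Lemma expect_norm_mul_le : \int[P]_w `|f w * g w| <=
  \int[P]_w `|f w| ^+ 3 + \int[P]_w `|g w| ^+ 3 + 1.
Proof.
have := @expect_mul3_le _ _ _ P _ _ (fun=> 1) mf mg (@measurable_cst _ _ _ _ _ _) Lf Lg L31.
by rewrite E31; under eq_Rintegral do rewrite mulr1.
Qed.

Lemma L3_L1 : L1 f.
Proof.
apply: (@L1_dominated _ _ _ _ _ (fun w => `|f w * 1 * 1|)) => //.
- by move=> w; rewrite !mulr1.
- exact: L3_mul3.
Qed.

Lemma expect_norm_le : \int[P]_w `|f w| <= \int[P]_w `|f w| ^+ 3 + 2.
Proof.
have m1 : measurable_fun setT (fun _ : T => 1 : R) by [].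
have := @expect_mul3_le _ _ _ P f (fun=> 1) (fun=> 1) mf m1 m1 Lf L31 L31.
rewrite E31; under eq_Rintegral do rewrite !mulr1.
by rewrite -addrA.
Qed.

End squares.

(** * Stein's method under local dependence *)

Section stein_local.
Context d (T : measurableType d) (R : realType) (P : probability T R).

Local Notation L1 f := (P.-integrable setT (EFin \o f)).
Local Notation L3 f := (L1 (fun w => `|f w| ^+ 3)).

Lemma indep_rv_compr (F G : T -> R) (g : R -> R) : measurable_fun setT g ->
  indep_rv P F G -> indep_rv P F (g \o G).
Proof.
move=> mg FG C D mC mD; rewrite comp_preimage; apply: FG => //.
by rewrite -[X in measurable X]setTI; exact: mg.
Qed.

(* [N1 i] contains the indices on which [z i] may depend, and [N2 i] those on
   which the products [z i * z j], [j] in [N1 i], may depend. *)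
Variables (I : finType) (z : I -> T -> R) (N1 N2 : rel I) (rho : R) (D : nat).
Hypotheses (mz : forall i, measurable_fun setT (z i)) (Lz : forall i, L3 (z i)).
Hypothesis z_rho : forall i, \int[P]_w `|z i w| ^+ 3 <= rho.
Hypothesis z0 : forall i, \int[P]_w z i w = 0.
Hypotheses (N12 : forall i j, N1 i j -> N2 i j) (N2D : forall i, (#|N2 i| <= D)%N).
Hypothesis ind1 : forall i, indep_rv P (z i) (fun w => \sum_(j | ~~ N1 i j) z j w).
Hypothesis ind2 : forall i j, N1 i j ->
  indep_rv P (fun w => z i w * z j w) (fun w => \sum_(k | ~~ N2 i k) z k w).
Variables (f f' : R -> R) (M0 M L b : R).
Hypotheses (ff' : forall x : R, is_derive x 1 f (f' x)) (fM : forall x, `|f x| <= M0).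
Hypotheses (f'M : forall x, `|f' x| <= M) (L0 : 0 <= L) (b0 : 0 <= b).
Hypothesis f'L : forall x y, `|f' x - f' y| <= L * `|x - y|.

Let U w := b * \sum_i z i w.
Let V i w := b * \sum_(j | ~~ N1 i j) z j w.
Let V' i w := b * \sum_(j | ~~ N2 i j) z j w.

Let mf : measurable_fun setT f.
Proof. exact: (lipschitz_measurable (derive_bounded_lipschitz ff' f'M)). Qed.
Let mf' : measurable_fun setT f'. Proof. exact: (lipschitz_measurable f'L). Qed.

Let mS (Q : pred I) : measurable_fun setT (fun w => \sum_(j | Q j) z j w).
Proof. exact: measurable_sum_cond. Qed.
Let mbS (Q : pred I) : measurable_fun setT (fun w => b * \sum_(j | Q j) z j w).
Proof. exact: measurable_funM. Qed.

Let mfV i : measurable_fun setT (fun w => f (V i w)).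
Proof. by apply: measurableT_comp => //; exact: mbS. Qed.
Let mf'V' i : measurable_fun setT (fun w => f' (V' i w)).
Proof. by apply: measurableT_comp => //; exact: mbS. Qed.
Let mfb : measurable_fun setT (fun x => f (b * x)).
Proof. by apply: measurableT_comp => //; exact: measurable_funM. Qed.
Let mf'b : measurable_fun setT (fun x => f' (b * x)).
Proof. by apply: measurableT_comp => //; exact: measurable_funM. Qed.

Let Lf'S (Q : pred I) : L1 (fun w => f' (b * \sum_(j | Q j) z j w)).
Proof. by apply: (@L1_bounded _ _ _ _ _ M) => //; exact: measurableT_comp. Qed.

Let LzfS i (Q : pred I) : L1 (fun w => z i w * f (b * \sum_(j | Q j) z j w)).
Proof.
apply: (@L1_mulr_bounded _ _ _ _ _ _ M0) => //; first exact: L3_L1.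
exact: measurableT_comp.
Qed.

Let Lzzf'S i j (Q : pred I) : L1 (fun w => z i w * z j w * f' (b * \sum_(j | Q j) z j w)).
Proof.
apply: (@L1_mulr_bounded _ _ _ _ _ _ M) => //; first exact: L3_mul.
exact: measurableT_comp.
Qed.

(** [V i] omits the neighbours of [i], so it is independent of the centred [z i]. *)
Let expect_far i : \int[P]_w (z i w * f (V i w)) = 0.
Proof.
rewrite (@indep_rv_expectM _ _ _ P (z i) (fun w => f (V i w))) ?z0 ?mul0r//.
- exact: (indep_rv_compr mfb (ind1 i)).
- exact: L3_L1.
- exact: (@L1_bounded _ _ _ _ _ M0).
Qed.

Let expect_zzV' i j : N1 i j -> \int[P]_w (z i w * z j w * f' (V' i w)) =
  \int[P]_w (z i w * z j w) * \int[P]_w f' (V' i w).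
Proof.
move=> Nij.
rewrite (@indep_rv_expectM _ _ _ P (fun w => z i w * z j w) (fun w => f' (V' i w)))//.
- exact: measurable_funM.
- exact: (indep_rv_compr mf'b (ind2 Nij)).
- exact: L3_mul.
- exact: Lf'S.
Qed.

Let norm_near i w : `|U w - V' i w| <= b * \sum_(k | N2 i k) `|z k w|.
Proof.
rewrite /U /V' (bigID (N2 i))/= mulrDr addrK normrM ger0_norm// ler_wpM2l//.
exact: ler_norm_sum.
Qed.

Let taylor i w : `|z i w * f (U w) - z i w * f (V i w)
     - b * \sum_(j | N1 i j) (z i w * z j w * f' (V' i w))| <=
  \sum_(j | N1 i j) \sum_(k | N2 i k) (2 * L * b ^+ 2) * `|z i w * z j w * z k w|.
Proof.
have UV : U w - V i w = b * \sum_(j | N1 i j) z j w.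
  by rewrite /U /V (bigID (N1 i))/= mulrDr addrK.
(* This is [z i] times the Taylor remainder of [f] from [V i] to [U], with slope at [V' i]. The
   factor [2] in the bound arises because [|U - V i|] and [|U - V' i|] are both at most [b * S2]. *)
have -> : z i w * f (U w) - z i w * f (V i w)
     - b * \sum_(j | N1 i j) (z i w * z j w * f' (V' i w)) =
  z i w * (f (U w) - f (V i w) - (U w - V i w) * f' (V' i w)).
  rewrite UV -mulr_suml -mulr_sumr; ring.
rewrite normrM.
set S1 := \sum_(j | N1 i j) `|z j w|; set S2 := \sum_(k | N2 i k) `|z k w|.
have UVS : `|U w - V i w| <= b * S1.
  by rewrite UV normrM ger0_norm// ler_wpM2l// ler_norm_sum.
have S12 : S1 <= S2.
  rewrite /S2 (bigID (N1 i))/= (eq_bigl (N1 i)); last first.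
    by move=> j; apply/andP/idP => [[]//|Nj]; split => //; exact: N12.
  by rewrite lerDl sumr_ge0.
have S10 : 0 <= S1 by rewrite sumr_ge0.
have -> : \sum_(j | N1 i j) \sum_(k | N2 i k) (2 * L * b ^+ 2) * `|z i w * z j w * z k w| =
   `|z i w| * (b * S1 * (L * (b * S2 + b * S2))).
  transitivity (\sum_(j | N1 i j) (2 * L * b ^+ 2 * `|z i w| * S2) * `|z j w|).
    apply: eq_bigr => j _; rewrite -mulr_sumr.
    transitivity (2 * L * b ^+ 2 * (`|z i w| * `|z j w| * S2)); last by ring.
    by congr (_ * _); rewrite /S2 mulr_sumr; apply: eq_bigr => k _; rewrite !normrM.
  by rewrite -mulr_sumr -/S1; ring.
rewrite ler_wpM2l//; apply: (le_trans (derive_taylor1 ff' L0 f'L _ _ _)).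
apply: ler_pM => //; first by rewrite mulr_ge0// addr_ge0.
rewrite ler_wpM2l// lerD//.
by rewrite (le_trans UVS)// ler_wpM2l.
Qed.

Let rho0 (i : I) : 0 <= rho.
Proof. by apply: le_trans (z_rho i); apply: Rintegral_ge0 => w _; rewrite exprn_ge0. Qed.

Let sum_D i (c : R) : 0 <= c -> \sum_(k | N2 i k) c <= D%:R * c.
Proof.
by move=> c0; rewrite sumr_const -[leLHS]mulr_natl ler_wpM2r// ler_nat N2D.
Qed.

Let sum_D1 i (c : R) : 0 <= c -> \sum_(k | N1 i k) c <= D%:R * c.
Proof.
move=> c0; apply: le_trans (sum_D i c0).
rewrite [leRHS](bigID (N1 i))/= [X in _ <= X + _](eq_bigl (N1 i)); last first.
  by move=> j; apply/andP/idP => [[]//|Nj]; split => //; exact: N12.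
by rewrite lerDl sumr_ge0.
Qed.

Let c3 := 2 * L * b ^+ 2.
Let c30 : 0 <= c3. Proof. by rewrite /c3 !mulr_ge0// exprn_ge0. Qed.

(** Expectation of the pointwise bound [taylor]: the term with [f (V i)] vanishes, and [V' i]
    decouples from the products [z i * z j]. There are at most [D ^ 2] pairs [(j, k)], each with a
    third-order moment at most [3 * rho]. *)
Let mean_taylor i : `|\int[P]_w (z i w * f (U w))
     - b * \sum_(j | N1 i j) \int[P]_w (z i w * z j w) * \int[P]_w f' (V' i w)| <=
  D%:R ^+ 2 * (c3 * (3 * rho)).
Proof.
have LzfU : L1 (fun w => z i w * f (U w)) by exact: LzfS.
have LzfV : L1 (fun w => z i w * f (V i w)) by exact: LzfS.
have Lsum : L1 (fun w => \sum_(j | N1 i j) (z i w * z j w * f' (V' i w))).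
  by apply: L1_sum => j; exact: Lzzf'S.
have Lbsum := L1Z b Lsum.
have Lzzz j k : L1 (fun w => c3 * `|z i w * z j w * z k w|) by apply/L1Z/L3_mul3.
have -> : \int[P]_w (z i w * f (U w))
     - b * \sum_(j | N1 i j) \int[P]_w (z i w * z j w) * \int[P]_w f' (V' i w) =
  \int[P]_w (z i w * f (U w) - z i w * f (V i w)
     - b * \sum_(j | N1 i j) (z i w * z j w * f' (V' i w))).
  rewrite RintegralB//; last exact: L1B.
  rewrite RintegralB// expect_far subr0 RintegralZl// Rintegral_sum; last first.
    by move=> j; exact: Lzzf'S.
  by congr (_ - b * _); apply: eq_bigr => j Nij; rewrite expect_zzV'.
apply: (le_trans (norm_expect_le_bound _ _ (taylor i))).
- by apply: L1B => //; exact: L1B.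
- by apply: L1_sum => j; apply: L1_sum => k; exact: Lzzz.
rewrite Rintegral_sum; last by move=> j; apply: L1_sum => k; exact: Lzzz.
apply: (@le_trans _ _ (\sum_(j | N1 i j) \sum_(k | N2 i k) c3 * (3 * rho))).
  apply: ler_sum => j _; rewrite Rintegral_sum//; apply: ler_sum => k _.
  rewrite RintegralZl//; last exact: L3_mul3.
  rewrite ler_wpM2l// (le_trans (expect_mul3_le _ _ _ _ _ _))//.
  have := z_rho i; have := z_rho j; have := z_rho k; lra.
have c0 : 0 <= c3 * (3 * rho) by rewrite !mulr_ge0// (rho0 i).
apply: (@le_trans _ _ (\sum_(j | N1 i j) D%:R * (c3 * (3 * rho)))).
  by apply: ler_sum => j _; exact: sum_D.
rewrite expr2 -mulrA; apply: sum_D1.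
by rewrite mulr_ge0.
Qed.

(** [V' i] was needed for independence only; going back to [U] gives every [i] the same factor, the
    mean of [f' (U)], which can then be taken out of the sum over [i]. *)
Let mean_far i : `|\int[P]_w f' (V' i w) - \int[P]_w f' (U w)| <= L * b * (D%:R * (rho + 2)).
Proof.
rewrite -RintegralB//; try exact: Lf'S.
have Lz1 k : L1 (fun w => `|z k w|) by apply: integrable_norm; exact: L3_L1.
have LS : L1 (fun w => \sum_(k | N2 i k) `|z k w|) by exact: L1_sum.
apply: (@le_trans _ _ (\int[P]_w (L * b * \sum_(k | N2 i k) `|z k w|))).
  apply: norm_expect_le_bound; [by apply: L1B; exact: Lf'S|exact: L1Z|].
  move=> w; rewrite (le_trans (f'L _ _))// -mulrA ler_wpM2l// distrC.
  exact: norm_near.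
rewrite RintegralZl// ler_wpM2l ?mulr_ge0// Rintegral_sum//.
apply: le_trans (sum_D i _); last by rewrite addr_ge0// (rho0 i).
apply: ler_sum => k _; rewrite (le_trans (expect_norm_le _ _))//.
by rewrite lerD2r.
Qed.

Let mean_local i : `|\int[P]_w (z i w * f (U w))
     - b * (\sum_(j | N1 i j) \int[P]_w (z i w * z j w)) * \int[P]_w f' (U w)| <=
  b ^+ 2 * (L * D%:R ^+ 2 * (6 * rho + (1 + 2 * rho) * (rho + 2))).
Proof.
have r0 := rho0 i.
rewrite -(subrKA (b * (\sum_(j | N1 i j) \int[P]_w (z i w * z j w)) * \int[P]_w f' (V' i w))).
apply: (le_trans (ler_normD _ _)).
(* The first summand is the Taylor error. The second is the error of replacing [V' i] by [U],
   multiplied by a bound on the sum of the moments [z i * z j]: at most [D] of them, each at most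
   [1 + 2 * rho]. *)
have -> : b ^+ 2 * (L * D%:R ^+ 2 * (6 * rho + (1 + 2 * rho) * (rho + 2))) =
  D%:R ^+ 2 * (c3 * (3 * rho)) +
  b * (D%:R * (1 + 2 * rho)) * (L * b * (D%:R * (rho + 2))) by rewrite /c3; ring.
apply: lerD.
  apply: le_trans (mean_taylor i).
  by rewrite -mulrA mulr_suml.
rewrite -mulrBr normrM ler_pM//.
rewrite normrM ger0_norm// ler_wpM2l// (le_trans (ler_norm_sum _ _ _))//.
apply: le_trans (sum_D1 i _); last by rewrite addr_ge0// mulr_ge0.
apply: ler_sum => j _; apply: (le_trans (norm_expect_le _)); first exact: L3_mul.
rewrite (le_trans (expect_norm_mul_le _ _ _ _))//.
have := z_rho i; have := z_rho j; lra.
Qed.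

(** The factor [b ^ 2] times the double sum is the variance of [U], since each [z i] is uncorrelated
    with the sum of its non-neighbours. The first error thus measures how far this variance is from
    [1]; the second adds up [#|I|] local errors of order [b ^ 2], with one more [b] from the factor
    in front of the sum. *)
Lemma stein_local :
  `|\int[P]_w f' (U w) - \int[P]_w (U w * f (U w))| <=
  M * `|1 - b ^+ 2 * \sum_i \sum_(j | N1 i j) \int[P]_w (z i w * z j w)| +
  b ^+ 3 * #|I|%:R * (L * D%:R ^+ 2 * (6 * rho + (1 + 2 * rho) * (rho + 2))).
Proof.
set K := L * D%:R ^+ 2 * _; set S := \sum_i _; set E' := \int[P]_w f' (U w).
have LzfU i : L1 (fun w => z i w * f (U w)) by exact: LzfS.
have -> : \int[P]_w (U w * f (U w)) = b * \sum_i \int[P]_w (z i w * f (U w)).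
  rewrite -Rintegral_sum// -RintegralZl//; last exact: L1_sum.
  by apply: eq_Rintegral => w _; rewrite -mulr_suml mulrA.
rewrite -(subrKA (b ^+ 2 * S * E')) (le_trans (ler_normD _ _))// lerD//.
  rewrite -{1}(mul1r E') -mulrBl normrM mulrC ler_wpM2r//.
  rewrite -[leRHS](@expect_cst _ _ _ P); apply: norm_expect_le_bound => //.
  - exact: Lf'S.
  - exact: L1_cst.
have -> : b ^+ 2 * S * E' - b * (\sum_i \int[P]_w (z i w * f (U w))) =
  - (b * \sum_i (\int[P]_w (z i w * f (U w)) -
                 b * (\sum_(j | N1 i j) \int[P]_w (z i w * z j w)) * E')).
  rewrite sumrB -mulr_suml -mulr_sumr -/S; ring.
rewrite normrN normrM ger0_norm// exprS -!mulrA ler_wpM2l//.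
apply: (le_trans (ler_norm_sum _ _ _)).
apply: (@le_trans _ _ (\sum_(i : I) b ^+ 2 * K)).
  by apply: ler_sum => i _; exact: mean_local.
rewrite sumr_const -[leLHS]mulr_natl le_eqVlt; apply/orP; left; apply/eqP; ring.
Qed.

End stein_local.

(** * The Stein equation *)

Section stein_equation.
Context (R : realType).
Notation leb := (@lebesgue_measure R).
Notation phi := (normal_pdf (0 : R) 1).

Lemma std_normal_pdfE (x : R) : phi x = normal_peak (1 : R) * expR (- (x ^+ 2 / 2)).
Proof. by rewrite normal_pdfE ?oner_neq0// /normal_fun subr0 expr1n mulNr. Qed.

Lemma Rintegral_std_normal_pdf : \int[leb]_x phi x = 1.
Proof. by rewrite /Rintegral integral_normal_pdf. Qed.

Variables (g : R -> R) (Lg A : R).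
Hypotheses (A0 : 0 < A) (gA : forall x, A <= `|x| -> g x = 0).
Hypothesis gL : forall x y, `|g x - g y| <= Lg * `|x - y|.
Hypothesis g0 : \int[leb]_x (g x * phi x) = 0.

Let h x := g x * phi x.
(** A bound for [|g|]: [g] vanishes at [A], and every point of [[-A, A]] is within [2 * A] of it. *)
Let G : R := `|Lg| * (2 * A).

Let gG x : `|g x| <= G.
Proof.
have G0 : 0 <= G by rewrite !mulr_ge0// ltW.
have [xA|xA] := leP A `|x|; first by rewrite gA// normr0.
rewrite -(subr0 (g x)) -(gA (x := A)); last by rewrite ger0_norm// ltW.
apply: (le_trans (gL _ _)); apply: (@le_trans _ _ (`|Lg| * `|x - A|)).
  by rewrite ler_wpM2r// ler_norm.
rewrite ler_wpM2l// (le_trans (ler_normB _ _))// (gtr0_norm A0).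
by move/ltW : xA; lra.
Qed.

Let mphi : measurable_fun setT phi. Proof. exact: measurable_normal_pdf. Qed.
Let mg : measurable_fun setT g. Proof. exact: (lipschitz_measurable gL). Qed.

Let Lphi : leb.-integrable setT (EFin \o phi).
Proof. exact: integrable_normal_pdf. Qed.

Let Lh : leb.-integrable setT (EFin \o h).
Proof.
have LGphi : leb.-integrable setT (EFin \o (fun x => G * phi x)).
  exact: (integrableZl measurableT G Lphi).
apply: le_integrable LGphi => //.
  by apply/measurable_EFinP; exact: measurable_funM.
move=> x _ /=; rewrite lee_fin normrM [leRHS]normrM ler_wpM2r// (le_trans (gG x))//.
exact: ler_norm.
Qed.

Let ch : continuous h.
Proof.
move=> x; apply: cvgM; first exact: (lipschitz_continuous gL).
by apply: continuous_normal_pdf; exact: oner_neq0.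
Qed.

(* The Stein solution is [F / phi]. As [g] has compact support and Gaussian mean
   zero, [F] vanishes outside [-A, A]; all bounds are then elementary. *)
Let F x := \int[leb]_(t in `]-oo, x]) h t.

Let is_derive_F (x : R) : is_derive x 1 F (h x).
Proof.
have [dF FE] : derivable F x 1 /\ derive1 F x = h x.
  apply: (@continuous_FTC1 R h -oo%O x (x + 1)) => //; first by rewrite ltrDl.
    by apply: integrableS Lh.
  - exact: ltNyr.
  - exact: ch.
by apply: DeriveDef => //; rewrite -derive1E FE.
Qed.

Let F0 x : A <= `|x| -> F x = 0.
Proof.
move=> xA; rewrite /F Rintegral_mkcond; have [x0|x0] := leP x 0.
  rewrite (_ : _ \_ _ = cst 0) ?Rintegral_cst ?mul0r//.
  apply/funext => t /=; rewrite patchE; case: ifPn => //.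
  rewrite inE/= in_itv/= => tx; rewrite /h gA ?mul0r// (le_trans xA)//.
  rewrite ler0_norm// ler0_norm ?lerN2//.
  exact: le_trans tx x0.
(* Here [x] is positive, hence at least [A], and the integrand vanishes beyond [x]: the integral is
   the one over the whole line, which is zero by [g0]. *)
rewrite -[RHS]g0; congr Rintegral; apply/funext => t; rewrite patchE; case: ifPn => //.
rewrite notin_setE/= in_itv/= => /negP; rewrite -ltNge => xt.
rewrite gA ?mul0r// (le_trans xA)// gtr0_norm// gtr0_norm ?(lt_trans x0)//.
exact: ltW.
Qed.

Let FG x : `|F x| <= G.
Proof.
apply: (@le_trans _ _ (\int[leb]_(t in `]-oo, x]) `|h t|)).
  apply: le_normr_Rintegral => //.
  by apply: integrableS Lh.
rewrite Rintegral_mkcond -[leRHS]mulr1 -Rintegral_std_normal_pdf -RintegralZl//.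
apply: le_Rintegral => //.
- rewrite -restrict_EFin; apply/integrable_restrict => //; rewrite setTI.
  apply: (integrableS measurableT) => //; exact: (integrable_norm Lh).
- exact: (integrableZl measurableT G Lphi).
move=> t _; rewrite patchE; case: ifPn => _.
  by rewrite normrM (ger0_norm (normal_pdf_ge0 _ _ _)) ler_wpM2r// normal_pdf_ge0.
by rewrite mulr_ge0 ?normal_pdf_ge0// (le_trans _ (gG 0)).
Qed.

(** The reciprocal of [phi], written so that the derivative [x * psi x] comes out directly. *)
Let psi x := expR (x ^+ 2 / 2) / normal_peak (1 : R).

Let peak0 : normal_peak (1 : R) != 0.
Proof. by rewrite gt_eqF// normal_peak_gt0// oner_neq0. Qed.

Let phi_psi x : phi x * psi x = 1.
Proof.
rewrite std_normal_pdfE /psi expRN; field.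
by rewrite peak0 /= gt_eqF// expR_gt0.
Qed.

Let is_derive_psi (x : R) : is_derive x 1 psi (x * psi x).
Proof.
rewrite /psi.
have -> : (fun x : R => expR (x ^+ 2 / 2) / normal_peak 1) =
  (normal_peak (1 : R))^-1 \*: (expR \o (2^-1 \*: (@GRing.exp R ^~ 2%N))).
  by apply/funext => t /=; rewrite /GRing.scale/= mulrC (mulrC (t ^+ 2)).
apply: is_derive_eq.
rewrite /GRing.scale/= (_ : 2^-1 *: x ^+ 2 = x ^+ 2 / 2 :> R); last by rewrite [LHS]mulrC.
by field; exact: peak0.
Qed.

Let f (x : R) : R := F x * psi x.
(** Set so that the Stein equation holds by construction; what has to be proved is that this is the
    derivative of [f]. *)
Let f' (x : R) : R := x * f x + g x.

(** Since [g] is only Lipschitz, [f'] need not be differentiable. Its bound and Lipschitz constant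
    come from those of [x * f x] and of [g]. On [[-A, A]] the factor [psi] is at most its value at
    [A], which gives [M0]. *)
Lemma stein_equation : exists (f f' : R -> R) (M0 M L : R),
  [/\ forall x : R, is_derive x 1 f (f' x), forall x, `|f x| <= M0,
      forall x, `|f' x| <= M, 0 <= L /\ (forall x y, `|f' x - f' y| <= L * `|x - y|) &
      forall x, f' x - x * f x = g x].
Proof.
pose M0 : R := G * (expR (A ^+ 2 / 2) / normal_peak (1 : R)).
pose M := A * M0 + G.
have peak_gt0 : 0 < normal_peak (1 : R) by rewrite normal_peak_gt0// oner_neq0.
have G0 : 0 <= G by exact: le_trans (gG 0).
have M00 : 0 <= M0 by rewrite mulr_ge0// mulr_ge0 ?expR_ge0// invr_ge0 ltW.
have f0 x : A <= `|x| -> f x = 0 by move=> /F0 F0x; rewrite /f F0x mul0r.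
have df (x : R) : is_derive x 1 f (f' x).
  have := @is_deriveM _ _ F psi x 1 _ _ (is_derive_F x) (is_derive_psi x).
  move=> /is_derive_eq; apply; rewrite /GRing.scale/= /f' /f /h.
  transitivity (x * (F x * psi x) + g x * (phi x * psi x)); first by ring.
  by rewrite phi_psi mulr1.
have fM0 x : `|f x| <= M0.
  have [xA|xA] := leP A `|x|; first by rewrite f0// normr0.
  rewrite /f normrM ler_pM// ger0_norm ?mulr_ge0 ?expR_ge0 ?invr_ge0 ?(ltW peak_gt0)//.
  rewrite ler_wpM2r ?invr_ge0 ?(ltW peak_gt0)// ler_expR ler_wpM2r//.
  by rewrite -[x ^+ 2]real_normK ?num_real// ler_sqr ?nnegrE// ltW.
have xf x : `|x * f x| <= A * M0.
  have [xA|xA] := leP A `|x|; first by rewrite f0// mulr0 normr0 mulr_ge0// ltW.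
  by rewrite normrM ler_pM// ltW.
have f'M x : `|f' x| <= M.
  by rewrite (le_trans (ler_normD _ _))// lerD.
have M1 : 0 <= M by exact: le_trans (f'M 0).
have fL := derive_bounded_lipschitz df f'M.
(* Outside [[-A, A]] both products vanish, so by symmetry one point may be assumed inside, where
   multiplication by [x] costs at most a factor [A]. *)
have xfL x y : `|x * f x - y * f y| <= (A * M + M0) * `|x - y|.
  wlog xA : x y / `|x| <= A.
    move=> hw; have [/hw//|/ltW xA] := leP `|x| A.
    have [/hw hy|/ltW yA] := leP `|y| A; first by rewrite distrC (distrC x).
    by rewrite !f0// !mulr0 subr0 normr0 mulr_ge0// addr_ge0// mulr_ge0// ltW.
  have -> : x * f x - y * f y = x * (f x - f y) + f y * (x - y) by ring.
  rewrite (le_trans (ler_normD _ _))// mulrDl (normrM x) (normrM (f y)) lerD//.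
    by rewrite -mulrA ler_pM.
  by rewrite ler_wpM2r.
exists f, f', M0, M, (A * M + M0 + `|Lg|); split=> //.
- split; first by rewrite !addr_ge0// mulr_ge0// ltW.
  move=> x y; rewrite /f' opprD addrACA (le_trans (ler_normD _ _))// mulrDl lerD//.
  by rewrite (le_trans (gL _ _))// ler_wpM2r// ler_norm.
- by move=> x; rewrite /f' addrAC subrr add0r.
Qed.

End stein_equation.

(** * From test functions to distribution functions *)

Section clamp.
Context (R : realType).

Definition clamp (x : R) : R := Num.max 0 (Num.min 1 x).

Lemma clamp_ge0 x : 0 <= clamp x. Proof. by rewrite /clamp le_max lexx. Qed.
Lemma clamp_le1 x : clamp x <= 1.
Proof. by rewrite /clamp ge_max ler01 ge_min lexx. Qed.
Lemma clamp_eq0 x : x <= 0 -> clamp x = 0.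
Proof. by move=> x0; apply/max_idPl; rewrite ge_min x0 orbT. Qed.
Lemma clamp_eq1 x : 1 <= x -> clamp x = 1.
Proof. by move=> x1; rewrite /clamp (min_idPl x1); apply/max_idPr. Qed.

Lemma clamp_lipschitz x y : `|clamp x - clamp y| <= `|x - y|.
Proof.
wlog xy : x y / y <= x.
  move=> h; have [/h//|/ltW/h] := leP y x; by rewrite distrC (distrC x).
rewrite (ger0_norm (x := x - y)) ?subr_ge0// ler_norml /clamp.
have [?|?] := leP 1 x; have [?|?] := leP 1 y; rewrite ?(max_idPr ler01);
  have [?|?] := leP 0 x; have [?|?] := leP 0 y; apply/andP; split; lra.
Qed.

Lemma min_lipschitz (a b c e : R) :
  `|Num.min a b - Num.min c e| <= `|a - c| + `|b - e|.
Proof.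
have := ler_norm (a - c); have := ler_norm (b - e).
have := ler_norm (c - a); have := ler_norm (e - b).
rewrite (distrC c) (distrC e) => ? ? ? ?.
by rewrite ler_norml; case: (leP a b); case: (leP c e) => ? ?; apply/andP; split; lra.
Qed.

End clamp.

Section normal_limit.
Context (R : realType).
Notation leb := (@lebesgue_measure R).
Notation phi := (normal_pdf (0 : R) 1).
Notation gauss := (normal_prob (0 : R) 1).

(** Dominated convergence with dominating function [phi]. *)
Lemma cvg_normal_prob_indic (u : nat -> R -> R) (O : set R) : measurable O ->
  (forall k, measurable_fun setT (u k)) -> (forall k t, 0 <= u k t <= 1) ->
  (forall t, \forall k \near \oo, u k t = \1_O t) ->
  (fun k => \int[leb]_t (u k t * phi t)) @ \oo --> fine (gauss O).
Proof.
move=> mO mu u01 uO.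
have mphi := measurable_normal_pdf (0 : R) 1.
have gO : gauss O = (\int[leb]_t (\1_O t * phi t)%:E)%E.
  rewrite /normal_prob integral_mkcond; apply: eq_integral => t _.
  rewrite patchE indicE; by case: (t \in O); rewrite ?mul1r ?mul0r.
apply: fine_cvg; rewrite fineK; last by rewrite fin_num_measure.
rewrite gO.
apply: (@dominated_cvg _ _ R leb setT measurableT
  (fun k t => (u k t * phi t)%:E) (fun t => (\1_O t * phi t)%:E) (EFin \o phi)) => //.
- by move=> k; apply/measurable_EFinP; apply: measurable_funM => //; exact: mu.
- move=> t _; apply: cvg_near_cst; by apply: filterS (uO t) => k ->.
- exact: integrable_normal_pdf.
- move=> k t _ /=; rewrite lee_fin normrM; case/andP: (u01 k t) => u0 u1.
  by rewrite !ger0_norm ?normal_pdf_ge0// ler_piMl// normal_pdf_ge0.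
Unshelve. all: by end_near. Qed.

(** A trapezoid: [1] on [[-k, k]], [0] outside [[-(k+1), k+1]], with slopes of modulus one. *)
Definition cutoff (k : nat) (t : R) : R := clamp (k.+1%:R - `|t|).

Lemma cutoff_eq0 k t : k.+1%:R <= `|t| -> cutoff k t = 0.
Proof. by move=> kt; rewrite /cutoff clamp_eq0// subr_le0. Qed.

Lemma cutoff_lipschitz k x y : `|cutoff k x - cutoff k y| <= 1 * `|x - y|.
Proof.
rewrite mul1r (le_trans (clamp_lipschitz _ _))// opprB addrC addrA subrK distrC.
exact: ler_dist_dist.
Qed.

Lemma cvg_cutoff : (fun k => \int[leb]_t (cutoff k t * phi t)) @ \oo --> (1 : R).
Proof.
have := @cvg_normal_prob_indic cutoff setT; rewrite probability_setT; apply=> //.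
- by move=> k; exact: (lipschitz_measurable (cutoff_lipschitz k)).
- by move=> k t; rewrite clamp_ge0 clamp_le1.
move=> t; near=> k; rewrite indicT /cutoff clamp_eq1//.
rewrite -natr1 -addrA (addrC 1) addrA lerDr subr_ge0.
by near: k; exact: nbhs_infty_ger.
Unshelve. all: by end_near. Qed.

(** A compactly supported Lipschitz approximation from below of the indicator of an open half-line
    ending at [x]; [s = 1] selects the left one and [s = -1] the right one. *)
Definition ramp (s x : R) (k : nat) (t : R) : R :=
  clamp (Num.min (k%:R * (s * (x - t))) (k.+1%:R - `|t|)).

Lemma ramp_lipschitz s x k t t' :
  `|ramp s x k t - ramp s x k t'| <= (k%:R * `|s| + 1) * `|t - t'|.
Proof.
rewrite (le_trans (clamp_lipschitz _ _))// (le_trans (min_lipschitz _ _ _ _))//.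
rewrite mulrDl mul1r lerD//.
  rewrite -mulrBr -mulrBr opprB addrC addrA subrK !normrM -mulrA.
  by rewrite (@ger0_norm _ k%:R)// (distrC t).
by rewrite opprB addrC addrA subrK distrC ler_dist_dist.
Qed.

Lemma measurable_ramp_set s x : measurable [set t : R | 0 < s * (x - t)].
Proof.
have -> : [set t | 0 < s * (x - t)] = setT `&` (fun t => s * (x - t)) @^-1` `]0, +oo[.
  by rewrite setTI; apply/seteqP; split=> t /=; rewrite in_itv/= andbT.
have mf : measurable_fun setT (fun t : R => s * (x - t)).
  by apply: measurable_funM => //; exact: measurable_funB.
exact: mf.
Qed.

Lemma cvg_ramp s x : (fun k => \int[leb]_t (ramp s x k t * phi t)) @ \oo -->
  fine (gauss [set t | 0 < s * (x - t)]).
Proof.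
apply: cvg_normal_prob_indic.
- exact: measurable_ramp_set.
- by move=> k; exact: (lipschitz_measurable (ramp_lipschitz s x k)).
- by move=> k t; rewrite clamp_ge0 clamp_le1.
move=> t; rewrite indicE; have [st|st] := ltP 0 (s * (x - t)).
  rewrite mem_set//; near=> k; rewrite /ramp clamp_eq1// le_min; apply/andP; split.
    rewrite -ler_pdivrMr//; near: k; exact: nbhs_infty_ger.
  rewrite -natr1 -addrA (addrC 1) addrA lerDr subr_ge0.
  by near: k; exact: nbhs_infty_ger.
rewrite memNset/=; last by apply/negP; rewrite -leNgt.
near=> k; rewrite /ramp clamp_eq0// ge_min; apply/orP; left.
by rewrite mulr_ge0_le0.
Unshelve. all: by end_near. Qed.

End normal_limit.

Lemma cvg_near_dist (R : realType) (u : nat -> R) (l e : R) : u @ \oo --> l ->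
  0 < e -> \forall n \near \oo, `|l - u n| < e.
Proof. by move=> /cvgrPdist_lt h e0; exact: h. Qed.

Section normal_convergence.
Context d (T : measurableType d) (R : realType) (P : probability T R).
Notation leb := (@lebesgue_measure R).
Notation phi := (normal_pdf (0 : R) 1).
Notation gauss := (normal_prob (0 : R) 1).
Local Notation L1 f := (P.-integrable setT (EFin \o f)).

Variables (W : nat -> T -> R) (C : R).
Hypotheses (mW : forall n, measurable_fun setT (W n)).
Hypotheses (LW : forall n, L1 (W n)) (WC : forall n, \int[P]_w `|W n w| <= C).
Hypothesis W_stein : forall (g : R -> R) (Lg A : R), 0 < A ->
  (forall x, A <= `|x| -> g x = 0) ->
  (forall x y, `|g x - g y| <= Lg * `|x - y|) ->
  \int[leb]_x (g x * phi x) = 0 ->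
  (fun n => \int[P]_w g (W n w)) @ \oo --> (0 : R).

(** A minorant linear in [|t|]: integrated against the law of [W n], it turns the bound on the first
    absolute moment into tightness. *)
Lemma cutoff_ge k (t : R) : 1 - `|t| / k.+1%:R <= cutoff k t.
Proof.
have k0 : (0 : R) < k.+1%:R by [].
have k1 : (1 : R) <= k.+1%:R by rewrite ler1n.
pose u := `|t| / k.+1%:R; have u0 : 0 <= u by rewrite divr_ge0.
have ck : k.+1%:R - `|t| = (1 - u) * k.+1%:R by rewrite mulrBl mul1r divfK// gt_eqF.
rewrite /cutoff ck -/u.
have [u1|u1] := leP u 1; last first.
  by rewrite (le_trans _ (clamp_ge0 _))// subr_le0 ltW.
have h : 1 - u <= (1 - u) * k.+1%:R by rewrite ler_peMr// subr_ge0.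
have [c1|c1] := leP 1 ((1 - u) * k.+1%:R); first by rewrite clamp_eq1// gerBl.
by rewrite /clamp (min_idPr (ltW c1)) le_max h orbT.
Qed.

Lemma ramp_eq0 (s x : R) k t : k.+1%:R <= `|t| -> ramp s x k t = 0.
Proof. by move=> kt; rewrite /ramp clamp_eq0// ge_min subr_le0 kt orbT. Qed.

Lemma ramp_le_indic (s x : R) k t : ramp s x k t <= \1_[set t | 0 < s * (x - t)] t.
Proof.
rewrite indicE; have [st|st] := ltP 0 (s * (x - t)); first by rewrite mem_set// clamp_le1.
rewrite memNset/=; last by apply/negP; rewrite -leNgt.
by rewrite /ramp clamp_eq0// ge_min mulr_ge0_le0.
Qed.

Lemma L1_lipschitz01 (u : R -> R) L : (forall x y, `|u x - u y| <= L * `|x - y|) ->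
  (forall x, 0 <= u x <= 1) -> leb.-integrable setT (EFin \o (fun t => u t * phi t)).
Proof.
move=> uL u01; apply: le_integrable (integrable_normal_pdf 0 1) => //.
  apply/measurable_EFinP; apply: measurable_funM; first exact: (lipschitz_measurable uL).
  exact: measurable_normal_pdf.
move=> t _ /=; rewrite lee_fin normrM; have /andP[u0 u1] := u01 t.
by rewrite ler_piMl// ger0_norm.
Qed.

Lemma expect_indic (A : set T) : measurable A -> \int[P]_w \1_A w = fine (P A).
Proof. by move=> mA; rewrite /Rintegral integral_indic// setIT. Qed.

(** The portmanteau inequality for an open half-line. The error [e] is shared equally between the
    approximation of the indicator by [ramp], the convergence for the mean-zero function [g], and
    the mass lost by the cutoff. *)
Lemma liminf_halfline (s x e : R) : 0 < e -> \forall n \near \oo,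
  fine (gauss [set t | 0 < s * (x - t)]) - e <=
  fine (P (W n @^-1` [set t | 0 < s * (x - t)])).
Proof.
move=> e0; set O := [set t | _]; have e30 : 0 < e / 3 by rewrite divr_gt0.
have ramp01 k t : 0 <= ramp s x k t <= 1 by rewrite clamp_ge0 clamp_le1.
have cut01 k (t : R) : 0 <= cutoff k t <= 1 by rewrite clamp_ge0 clamp_le1.
have [k _ /(_ k (leqnn k)) hk] := cvg_near_dist (@cvg_ramp R s x) e30.
have h2 : 0 < (2 : R)^-1 by [].
have [K1 _ hK1] := cvg_near_dist (@cvg_cutoff R) h2.
have [K2 _ hK2] := @nbhs_infty_ger R (C / (e / 3)).
pose K := maxn K1 K2.
have {hK1}hK1 := hK1 K (leq_maxl _ _); have {hK2}hK2 := hK2 K (leq_maxr _ _).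
set I := \int[leb]_t (ramp s x k t * phi t) in hk.
set J := \int[leb]_t (cutoff K t * phi t) in hK1.
have Lr := L1_lipschitz01 (ramp_lipschitz s x k) (ramp01 k).
have Lc := L1_lipschitz01 (cutoff_lipschitz K) (cut01 K).
have Lphi := integrable_normal_pdf (0 : R) 1.
have J1 : J <= 1.
  rewrite -(@Rintegral_std_normal_pdf R); apply: le_Rintegral => // t _.
  by have /andP[_ c1] := cut01 K t; rewrite ler_piMl ?normal_pdf_ge0.
have I1 : I <= 1.
  rewrite -(@Rintegral_std_normal_pdf R); apply: le_Rintegral => // t _.
  by have /andP[_ c1] := ramp01 k t; rewrite ler_piMl ?normal_pdf_ge0.
have I0 : 0 <= I.
  by apply: Rintegral_ge0 => t _; rewrite mulr_ge0 ?normal_pdf_ge0//; case/andP: (ramp01 k t).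
have J0 : 0 < J by move: hK1; rewrite ltr_norml => /andP[_]; lra.
(* [g] has Gaussian mean zero, so [E ramp(W n)] is close to [I / J * E cutoff(W n)],
   and [E cutoff(W n)] is close to [1] by Markov's inequality. *)
pose g t := ramp s x k t - I / J * cutoff K t.
have g_cvg : (fun n => \int[P]_w g (W n w)) @ \oo --> (0 : R).
  apply: (@W_stein g (k%:R * `|s| + 1 + `|I / J| * 1) (maxn k K).+1%:R) => //.
  - move=> t kt; rewrite /g ramp_eq0 ?cutoff_eq0 ?mulr0 ?subr0//;
      by apply: le_trans kt; rewrite ler_nat ltnS ?leq_maxl ?leq_maxr.
  - move=> t t'; rewrite /g opprD addrACA (le_trans (ler_normD _ _))// mulrDl lerD//.
      exact: ramp_lipschitz.
    by rewrite -opprD normrN -mulrBr normrM -mulrA ler_wpM2l// cutoff_lipschitz.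
  transitivity (\int[leb]_t (ramp s x k t * phi t - I / J * (cutoff K t * phi t))).
    by apply: eq_Rintegral => t _; rewrite /g mulrBl mulrA.
  rewrite RintegralB//; last exact: (integrableZl measurableT (I / J) Lc).
  by rewrite RintegralZl// -/I -/J divfK ?subrr// gt_eqF.
have mr n : measurable_fun setT (fun w => ramp s x k (W n w)).
  by apply: measurableT_comp => //; exact: (lipschitz_measurable (ramp_lipschitz s x k)).
have mc n : measurable_fun setT (fun w => cutoff K (W n w)).
  by apply: measurableT_comp => //; exact: (lipschitz_measurable (cutoff_lipschitz K)).
have Lrn n : L1 (fun w => ramp s x k (W n w)).
  by apply: (@L1_bounded _ _ _ _ _ 1) => // w; rewrite ger0_norm ?clamp_ge0 ?clamp_le1.
have Lcn n : L1 (fun w => cutoff K (W n w)).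
  by apply: (@L1_bounded _ _ _ _ _ 1) => // w; rewrite ger0_norm ?clamp_ge0 ?clamp_le1.
near=> n.
have gn : - (e / 3) <= \int[P]_w g (W n w).
  have : `|0 - \int[P]_w g (W n w)| < e / 3.
    by near: n; exact: (cvg_near_dist g_cvg).
  by rewrite sub0r normrN ltr_norml => /andP[/ltW].
have cn : 1 - e / 3 <= \int[P]_w cutoff K (W n w).
  apply: (@le_trans _ _ (\int[P]_w (1 - `|W n w| / K.+1%:R))).
    rewrite RintegralB//; [|exact: L1_cst|]; last first.
      by rewrite /comp; under eq_fun do rewrite mulrC; apply: L1Z; exact: integrable_norm.
    rewrite expect_cst RintegralZr//; last exact: integrable_norm.
    rewrite lerB// ler_pdivrMr// (le_trans (WC n))// mulrC -ler_pdivrMr//.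
    by rewrite (le_trans hK2)// ler_nat.
  apply: le_expect => //; last by move=> w; exact: cutoff_ge.
  apply: L1B; first exact: L1_cst.
  by rewrite /comp; under eq_fun do rewrite mulrC; apply: L1Z; exact: integrable_norm.
have gE : \int[P]_w g (W n w) =
    \int[P]_w ramp s x k (W n w) - I / J * \int[P]_w cutoff K (W n w).
  by rewrite RintegralB//; [rewrite RintegralZl//|exact: L1Z].
have mO : measurable (W n @^-1` O).
  rewrite -[X in measurable X]setTI; apply: mW => //; exact: measurable_ramp_set.
have rO : \int[P]_w ramp s x k (W n w) <= fine (P (W n @^-1` O)).
  rewrite -expect_indic//; apply: le_expect => //; first exact: integrable_indic.
  by move=> w; rewrite (le_trans (ramp_le_indic _ _ _ _)).
(* Only a lower bound is sought, so [0 < J <= 1] suffices and [J] need not be close to [1]. *)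
have IJ : I <= I / J by rewrite ler_pdivlMr// ler_piMr.
have IJc : I * (1 - e / 3) <= I / J * \int[P]_w cutoff K (W n w).
  have [e1|e1] := leP (e / 3) 1.
    by rewrite ler_pM// subr_ge0.
  apply: (@le_trans _ _ 0); first by rewrite mulr_ge0_le0// subr_le0 ltW.
  rewrite mulr_ge0 ?divr_ge0 ?(ltW J0)//.
  by apply: Rintegral_ge0 => w _; exact: clamp_ge0.
have Ie : I * (e / 3) <= e / 3 by rewrite ler_piMl// ltW.
apply: le_trans rO; rewrite gE in gn.
move: hk; rewrite ltr_norml => /andP[_ hk].
by lra.
Unshelve. all: by end_near. Qed.

(** The lower bound on the left half-line bounds the distribution function from below; the one on
    the right half-line bounds it from above by complementation. Open and closed half-lines have the
    same Gaussian measure, as there is a density. *)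
Theorem cvg_dist_std_normal_of_stein : cvg_dist_std_normal P W.
Proof.
move=> x; apply/cvgrPdist_le => e e0.
have mx n : measurable (W n @^-1` `]-oo, x]).
  by rewrite -[X in measurable X]setTI; exact: mW.
have glt : fine (gauss [set t | 0 < 1 * (x - t)]) = fine (gauss `]-oo, x]).
  congr fine; rewrite /normal_prob -integral_itv_bndo_bndc.
    congr integral; apply/seteqP; split=> t /=; by rewrite in_itv/= mul1r subr_gt0.
  apply/measurable_EFinP/measurable_funTS; exact: measurable_normal_pdf.
have ggt : fine (gauss [set t | 0 < -1 * (x - t)]) = 1 - fine (gauss `]-oo, x]).
  have -> : [set t | 0 < -1 * (x - t)] = ~` `]-oo, x].
    apply/seteqP; split=> t /=; rewrite in_itv/= mulN1r opprB subr_gt0.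
      by move=> xt; apply/negP; rewrite -ltNge.
    by move/negP; rewrite -ltNge.
  by rewrite probability_setC// fineB// fin_num_measure.
have Pgt n : fine (P (W n @^-1` [set t | 0 < -1 * (x - t)])) = 1 - fine (P (W n @^-1` `]-oo, x])).
  have -> : W n @^-1` [set t | 0 < -1 * (x - t)] = ~` (W n @^-1` `]-oo, x]).
    apply/seteqP; split=> t /=; rewrite in_itv/= mulN1r opprB subr_gt0.
      by move=> xt; apply/negP; rewrite -ltNge.
    by move/negP; rewrite -ltNge.
  by rewrite probability_setC// fineB// fin_num_measure.
have Plt n : fine (P (W n @^-1` [set t | 0 < 1 * (x - t)])) <= fine (P (W n @^-1` `]-oo, x])).
  rewrite fine_le ?fin_num_measure//; last first.
    rewrite le_measure ?inE// => [|t /=]; last by rewrite in_itv/= mul1r subr_gt0 => /ltW.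
    by rewrite -[X in measurable X]setTI; apply: mW => //; exact: measurable_ramp_set.
  by rewrite -[X in measurable X]setTI; apply: mW => //; exact: measurable_ramp_set.
near=> n.
have h1 : fine (gauss [set t | 0 < 1 * (x - t)]) - e <=
  fine (P (W n @^-1` [set t | 0 < 1 * (x - t)])) by near: n; exact: liminf_halfline.
have h2 : fine (gauss [set t | 0 < -1 * (x - t)]) - e <=
  fine (P (W n @^-1` [set t | 0 < -1 * (x - t)])) by near: n; exact: liminf_halfline.
have := Plt n; move: h1 h2; rewrite glt ggt Pgt => h1 h2 h3.
by rewrite ler_norml; apply/andP; split; lra.
Unshelve. all: by end_near. Qed.

End normal_convergence.

(** * Sums of an m-dependent and an independent sequence *)

Section neighbourhoods.
Variables (K n : nat).

Definition emb (s : 'I_K + 'I_n) : nat + nat :=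
  match s with inl i => inl (val i) | inr k => inr (val k) end.

(** Subtraction on [nat] is truncated, so the conjunction says that the distance of [i] and [j] is
    at most [r]. An [inr] index has no neighbour but itself, since the [Y_k] are independent. *)
Definition nbr (r : nat) (s t : 'I_K + 'I_n) : bool :=
  match s, t with
  | inl i, inl j => (i - j <= r)%N && (j - i <= r)%N
  | inr k, inr l => k == l
  | _, _ => false
  end.

Lemma nbr_refl r s : nbr r s s.
Proof. by case: s => [i|k] /=; rewrite ?eqxx// subnn. Qed.

Lemma nbr_sub r r' s t : (r <= r')%N -> nbr r s t -> nbr r' s t.
Proof. by case: s t => [i|k] [j|l] //=; lia. Qed.

(** All neighbours lie on the same side as [s], so forgetting the side is injective on them; their
    values fit into [2 * r + 1] consecutive integers. *)
Lemma card_nbr r s : (#|nbr r s| <= (2 * r).+1)%N.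
Proof.
pose h (t : 'I_K + 'I_n) : nat := match t with inl j => j | inr k => k end.
rewrite cardE -(size_map h) -(size_iota (h s - r) (2 * r).+1).
apply: uniq_leq_size.
  rewrite map_inj_in_uniq ?enum_uniq// => t t'; rewrite !mem_enum !unfold_in /h.
  by case: s t t' => [i|k] [j|l] [j'|l'] //= _ _ /val_inj ->.
move=> x /mapP[t]; rewrite mem_enum unfold_in => st -> {x}; rewrite mem_iota.
by case: s t st => [i|k] [j|l] //=; [lia|move=> /eqP ->; lia].
Qed.

End neighbourhoods.

Section dependent_family.
Context d (T : measurableType d) (R : realType) (P : probability T R).

Local Notation L1 f := (P.-integrable setT (EFin \o f)).
Local Notation L3 f := (L1 (fun w => `|f w| ^+ 3)).

(** Nothing is required between an [inl] and an [inr] index: the two underlying sequences are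
    independent. *)
Definition m_separated (m : nat) (F G : set (nat + nat)) :=
  (forall i j, F (inl i) -> G (inl j) -> (m < i - j)%N || (m < j - i)%N) /\
  (forall k, F (inr k) -> ~ G (inr k)).

Variables (Z : nat + nat -> T -> R) (m : nat) (rho : R).
Hypotheses (mZ : forall s, measurable_fun setT (Z s)) (LZ : forall s, L3 (Z s)).
Hypotheses (Z_rho : forall s, \int[P]_w `|Z s w| ^+ 3 <= rho).
Hypothesis Z0 : forall s, \int[P]_w Z s w = 0.
Hypothesis Z_ind : forall F G, finite_set F -> finite_set G -> m_separated m F G ->
  indep_sets P (cyl Z F) (cyl Z G).

Lemma expect_separated s t : m_separated m [set s] [set t] ->
  \int[P]_w (Z s w * Z t w) = 0.
Proof.
move=> st; rewrite indep_rv_expectM ?Z0 ?mul0r//; [|exact: L3_L1|exact: L3_L1].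
apply: (indep_rv_cyl mZ (finite_set1 s) (finite_set1 t)); first exact: Z_ind.
- exact: measurable_cyl.
- exact: measurable_cyl.
Qed.

Section stein_sum.
Variables (K n : nat).
Let z (s : 'I_K + 'I_n) := Z (emb s).

Let near r s : set (nat + nat) := (@emb K n) @` [set t | nbr r s t].
Let far r s : set (nat + nat) := (@emb K n) @` [set t | ~~ nbr r s t].

Let finite_near r s : finite_set (near r s).
Proof. by apply: finite_image; exact: finite_finset. Qed.
Let finite_far r s : finite_set (far r s).
Proof. by apply: finite_image; exact: finite_finset. Qed.

(** Triangle inequality. It is used with [r = 0], where the near set is [s] alone, and with [r = m];
    this dictates the radii [m] and [m + m] of the two neighbourhoods. *)
Let separated_near_far r s : m_separated m (near r s) (far (r + m) s).
Proof.
split.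
- move=> _ _ [[i|//] + [<-]] [[j|//] + [<-]] /=.
  by case: s => [i0|k0] //=; lia.
- move=> _ [[//|k] sk [<-]] [[//|l] nsl [/val_inj lk]].
  by move: sk nsl; rewrite lk; case: s => [i0|k0] //= ->.
Qed.

Let measurable_near r s t : nbr r s t ->
  measurable_fun (setT : set (g_sigma_algebraType (cyl Z (near r s)))) (z t).
Proof. by move=> st; apply: measurable_cyl; exists t. Qed.

Let measurable_far r s :
  measurable_fun (setT : set (g_sigma_algebraType (cyl Z (far r s))))
    (fun w => \sum_(t | ~~ nbr r s t) z t w).
Proof.
by apply: measurable_sum_cond => t st; apply: measurable_cyl; exists t.
Qed.

Lemma stein_sum (f f' : R -> R) (M0 M L b : R) :
  (forall x : R, is_derive x 1 f (f' x)) -> (forall x, `|f x| <= M0) ->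
  (forall x, `|f' x| <= M) -> 0 <= L ->
  (forall x y, `|f' x - f' y| <= L * `|x - y|) -> 0 <= b ->
  let U w := b * (\sum_(i < K) Z (inl (val i)) w + \sum_(k < n) Z (inr (val k)) w) in
  `|\int[P]_w f' (U w) - \int[P]_w (U w * f (U w))| <=
  M * `|1 - b ^+ 2 * (\sum_(i < K) \sum_(j < K)
            \int[P]_w (Z (inl (val i)) w * Z (inl (val j)) w) +
          \sum_(k < n) \int[P]_w (Z (inr (val k)) w * Z (inr (val k)) w))| +
  b ^+ 3 * (K + n)%:R * (L * (2 * (m + m)).+1%:R ^+ 2 *
                         (6 * rho + (1 + 2 * rho) * (rho + 2))).
Proof.
move=> ff' fM f'M L0 f'L b0; cbv zeta.
pose U w := b * (\sum_(i < K) Z (inl (val i)) w + \sum_(k < n) Z (inr (val k)) w).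
have mN12 (s t : 'I_K + 'I_n) : nbr m s t -> nbr (m + m) s t by apply: nbr_sub; rewrite leq_addr.
have ind1 s : indep_rv P (z s) (fun w => \sum_(t | ~~ nbr m s t) z t w).
  apply: (indep_rv_cyl mZ (@finite_near 0%N s) (@finite_far m s)).
  - by apply: Z_ind => //; have := @separated_near_far 0%N s; rewrite add0n.
  - by apply: measurable_near; exact: nbr_refl.
  - exact: measurable_far.
have ind2 s t : nbr m s t -> indep_rv P (fun w => z s w * z t w)
    (fun w => \sum_(k | ~~ nbr (m + m) s k) z k w).
  move=> st; apply: (indep_rv_cyl mZ (@finite_near m s) (@finite_far (m + m) s)).
  - exact: Z_ind.
  - by apply: measurable_funM; apply: measurable_near => //; exact: nbr_refl.
  - exact: measurable_far.
have := @stein_local _ _ _ P _ z (nbr m) (nbr (m + m)) rho (2 * (m + m)).+1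
  (fun s => mZ (emb s)) (fun s => LZ (emb s)) (fun s => Z_rho (emb s))
  (fun s => Z0 (emb s)) (@mN12) (fun s => card_nbr (m + m) s) ind1 ind2
  f f' M0 M L b ff' fM f'M L0 b0 f'L.
have UE w : b * \sum_i z i w = U w by rewrite big_sumType.
cbv beta zeta.
under eq_Rintegral do rewrite UE.
under [X in _ - X]eq_Rintegral do rewrite UE.
rewrite card_sum !card_ord big_sumType/=.
congr (_ <= _ * `|_ - _ * (_ + _)| + _).
(* Indices more than [m] apart are uncorrelated, so the sum over neighbours may be extended to all
   [j]. *)
- apply: eq_bigr => i _; rewrite big_sumType/= [X in _ + X]big_pred0// addr0.
  rewrite big_mkcond; apply: eq_bigr => j _; case: ifPn => // ij.
  rewrite expect_separated//; split => // i' j' [->] [->].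
  by move: ij => /=; lia.
- apply: eq_bigr => k _; rewrite big_sumType/= big_pred0// add0r.
  by rewrite (big_pred1 k)// => l; rewrite eq_sym.
Qed.

End stein_sum.
End dependent_family.

Lemma measurable_random_index d (T : measurableType d) (R : realType)
    (N : T -> nat) (f : nat -> T -> R) :
  (forall l, measurable [set w | N w = l]) -> (forall l, measurable_fun setT (f l)) ->
  measurable_fun setT (fun w => f (N w) w).
Proof.
move=> mN mf _ C mC; rewrite setTI.
have -> : (fun w => f (N w) w) @^-1` C = \bigcup_l ([set w | N w = l] `&` f l @^-1` C).
  by apply/seteqP; split=> [w fw|w [l _ [/= <-]]]//; exists (N w).
apply: bigcup_measurable => l _; apply: measurableI; first exact: mN.
by rewrite -[X in measurable X]setTI; exact: mf.
Qed.

(** * Variances of blocks and of randomly indexed partial sums *)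

Section block_variance.
Context d (T : measurableType d) (R : realType) (P : probability T R).

Local Notation L1 f := (P.-integrable setT (EFin \o f)).
Local Notation L3 f := (L1 (fun w => `|f w| ^+ 3)).

Variables (Z : nat + nat -> T -> R) (m : nat) (a : nat -> R).
Hypotheses (mZ : forall s, measurable_fun setT (Z s)) (LZ : forall s, L3 (Z s)).
Hypothesis Z0 : forall s, \int[P]_w Z s w = 0.
Hypothesis Z_ind : forall F G, finite_set F -> finite_set G -> m_separated m F G ->
  indep_sets P (cyl Z F) (cyl Z G).
Hypothesis Za : forall i l, \int[P]_w (Z (inl i) w * Z (inl (i + l)%N) w) = a l.

Let gam i j := \int[P]_w (Z (inl i) w * Z (inl j) w).

Definition block_var k := \sum_(i < k) \sum_(j < k) gam i j.
Definition long_run_var := a 0%N + 2 * \sum_(1 <= l < m.+1) a l.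
Let s2 := long_run_var.

Let gamC i j : gam i j = gam j i.
Proof. by apply: eq_Rintegral => w _; rewrite mulrC. Qed.

Let gamE i j : (i <= j)%N -> gam i j = a (j - i).
Proof. by move=> ij; rewrite /gam -(Za i) subnKC. Qed.

Let gam_shift s i j : gam (s + i) (s + j) = gam i j.
Proof.
wlog ij : i j / (i <= j)%N.
  by move=> h; have [/h//|/ltnW/h] := leqP i j; rewrite gamC (gamC j).
by rewrite !gamE ?leq_add2l// subnDl.
Qed.

Let a_far l : (m < l)%N -> a l = 0.
Proof.
move=> ml; rewrite -(Za 0%N) add0n; apply: (expect_separated mZ LZ Z0 Z_ind).
by split => // i j [->] [->]; rewrite subn0 ml orbT.
Qed.

(* Adding one index at a time avoids counting pairs near the end of the block. *)
Let block_varS k : block_var k.+1 = block_var k + a 0%N + 2 * \sum_(1 <= l < k.+1) a l.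
Proof.
have e : \sum_(j < k) gam j k = \sum_(1 <= l < k.+1) a l.
  rewrite big_add1 /= big_mkord (reindex_inj rev_ord_inj)/=; apply: eq_bigr => j _.
  rewrite gamE; last by rewrite leq_subr.
  by congr a; have := ltn_ord j; lia.
rewrite /block_var big_ord_recr/=; under eq_bigr do rewrite big_ord_recr/=.
rewrite big_split/= big_ord_recr/= e (gamE (leqnn k)) subnn.
have -> : \sum_(i < k) gam k i = \sum_(1 <= l < k.+1) a l.
  by rewrite -e; apply: eq_bigr => i _; rewrite gamC.
ring.
Qed.

(** Past [m], each new index adds exactly [s2], as covariances at lags beyond [m] vanish. The
    deviation from linear growth stays frozen at its value at [m]. *)
Let block_var_large k : block_var (m + k) = block_var m + k%:R * s2.
Proof.
elim: k => [|k IH]; first by rewrite addn0 mul0r addr0.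
rewrite addnS block_varS IH -natr1 mulrDl mul1r addrA.
suff -> : \sum_(1 <= l < (m + k).+1) a l = \sum_(1 <= l < m.+1) a l.
  by rewrite /s2 /long_run_var; ring.
rewrite (@big_cat_nat _ _ _ m.+1)//= ?ltnS ?leq_addr//.
rewrite [X in _ + X]big_nat_cond [X in _ + X]big1 ?addr0// => l.
by rewrite andbT => /andP[ml _]; exact: a_far.
Qed.

(** A sum used as a convenient maximum over [k <= m]; the deviation for larger [k] equals the one at
    [m]. *)
Definition block_var_error := \sum_(k < m.+1) `|block_var k - k%:R * s2|.

Lemma block_var_error_ge0 : 0 <= block_var_error.
Proof. by rewrite sumr_ge0. Qed.

Lemma block_var_approx k : `|block_var k - k%:R * s2| <= block_var_error.
Proof.
have small l : (l < m.+1)%N -> `|block_var l - l%:R * s2| <= block_var_error.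
  move=> lm; rewrite /block_var_error (bigD1 (Ordinal lm))//= lerDl.
  by rewrite sumr_ge0.
have [km|mk] := leqP k m; first exact: small.
rewrite -(subnKC (ltnW mk)) block_var_large natrD mulrDl opprD addrACA subrr addr0.
exact: small.
Qed.

(** No additive constant remains: the empty block has variance zero, and for [k >= 1] the error is
    absorbed into the slope. This makes the increment bound proportional to [|l - k|]. *)
Lemma block_var_linear k : block_var k <= k%:R * (block_var_error + `|s2|).
Proof.
case: k => [|k]; first by rewrite /block_var big_ord0 mul0r.
have := block_var_approx k.+1; rewrite ler_norml => /andP[_].
have k1 : (1 : R) <= k.+1%:R by rewrite ler1n.
have := block_var_error_ge0; set e := block_var_error => e0.
have h1 : e <= k.+1%:R * e by rewrite ler_peMl.
have h2 : k.+1%:R * s2 <= k.+1%:R * `|s2| by rewrite ler_wpM2l// ler_norm.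
by lra.
Qed.

Definition psum l w := \sum_(i < l) Z (inl (val i)) w.

Lemma L1_sum_sqr (I : finType) (z : I -> nat + nat) : L1 (fun w => (\sum_i Z (z i) w) ^+ 2).
Proof.
have -> : (fun w => (\sum_i Z (z i) w) ^+ 2) =
    fun w => \sum_i \sum_j (Z (z i) w * Z (z j) w).
  by apply/funext => w; rewrite expr2 mulr_suml; apply: eq_bigr => i _; rewrite mulr_sumr.
by do 2 (apply: L1_sum => ?); exact: L3_mul.
Qed.

Lemma expect_sum_sqr (I : finType) (z : I -> nat + nat) :
  \int[P]_w (\sum_i Z (z i) w) ^+ 2 =
  \sum_i \sum_j \int[P]_w (Z (z i) w * Z (z j) w).
Proof.
transitivity (\int[P]_w (\sum_i \sum_j (Z (z i) w * Z (z j) w))).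
  apply: eq_Rintegral => w _; rewrite expr2 mulr_suml; apply: eq_bigr => i _.
  by rewrite mulr_sumr.
rewrite Rintegral_sum => [|i]; last by apply: L1_sum => j; exact: L3_mul.
by apply: eq_bigr => i _; rewrite Rintegral_sum// => j; exact: L3_mul.
Qed.

Let psumB k l w : (k <= l)%N ->
  psum l w - psum k w = \sum_(i < (l - k)%N) Z (inl (k + i)%N) w.
Proof.
move=> /subnKC; rewrite /psum; move: (l - k)%N => r <-.
by apply/eqP; rewrite subr_eq addrC big_split_ord/=; apply/eqP; congr (_ + _).
Qed.

(** The increment is a sum over [|l - k|] consecutive indices, and covariances are shift
    invariant. *)
Lemma psum_incr_var k l : L1 (fun w => (psum l w - psum k w) ^+ 2) /\
  \int[P]_w (psum l w - psum k w) ^+ 2 <=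
    (block_var_error + `|s2|) * `|l%:R - k%:R|.
Proof.
wlog kl : k l / (k <= l)%N.
  move=> h; have [/h//|/ltnW/h] := leqP k l; rewrite distrC.
  have -> : (fun w => (psum k w - psum l w) ^+ 2) = (fun w => (psum l w - psum k w) ^+ 2).
    by apply/funext => w; rewrite -sqrrN opprB.
  by [].
have -> : (fun w => (psum l w - psum k w) ^+ 2) =
    (fun w => (\sum_(i < (l - k)%N) Z (inl (k + i)%N) w) ^+ 2).
  by apply/funext => w; rewrite psumB.
split; first exact: (L1_sum_sqr (fun i : 'I_(l - k) => inl (k + i)%N)).
rewrite (expect_sum_sqr (fun i : 'I_(l - k) => inl (k + i)%N)).
rewrite -natrB// normr_nat mulrC; apply: le_trans (block_var_linear _).
rewrite /block_var; apply: ler_sum => i _; apply: ler_sum => j _.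
by rewrite -[leLHS]/(gam (k + i) (k + j)) gam_shift.
Qed.

Section random_index.
Variables (n K : nat) (N : T -> nat) (y : nat -> R).
(** Makes [N = l] a level set of the sum of the [Z (inr k)], hence an event independent of all
    [Z (inl i)]. *)
Hypothesis Ny : forall w l, N w = l <-> \sum_(k < n) Z (inr (val k)) w = y l.
Hypothesis LN : L1 (fun w => (N w)%:R : R).

Let c := block_var_error + `|s2|.
Let c0 : 0 <= c. Proof. by rewrite addr_ge0// block_var_error_ge0. Qed.

Let D l w := (psum l w - psum K w) ^+ 2.
Let E l := [set w | N w = l].

Let mpsum l : measurable_fun setT (psum l).
Proof. by apply: measurable_sum_cond. Qed.

Let mD l : measurable_fun setT (D l).
Proof. by apply: measurable_funX; exact: measurable_funB. Qed.

Let EE l : E l = (fun w => \sum_(k < n) Z (inr (val k)) w) @^-1` [set y l].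
Proof. by apply/seteqP; split=> w /= /Ny. Qed.

Let mE l : measurable (E l).
Proof.
rewrite EE -[X in measurable X]setTI.
have mS : measurable_fun setT (fun w => \sum_(k < n) Z (inr (val k)) w).
  exact: measurable_sum_cond.
by apply: mS => //; exact: measurable_set1.
Qed.

Let mED l : measurable_fun setT (fun w => \1_(E l) w * D l w).
Proof. by apply: measurable_funM. Qed.

Let indep_ED l : indep_rv P \1_(E l) (D l).
Proof.
pose F : set (nat + nat) := inr @` `I_n.
pose G : set (nat + nat) := inl @` `I_(maxn l K).
have fF : finite_set F by apply: finite_image; exact: finite_II.
have fG : finite_set G by apply: finite_image; exact: finite_II.
apply: (indep_rv_cyl mZ fF fG).
- apply: Z_ind => //; split; first by move=> i j [].
  by move=> k _ [].
- apply: measurable_indic; rewrite EE -[X in measurable X]setTI.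
  have mS : measurable_fun (setT : set (g_sigma_algebraType (cyl Z F)))
      (fun w => \sum_(k < n) Z (inr (val k)) w).
    apply: measurable_sum_cond => k _; apply: measurable_cyl.
    by exists (val k) => //=.
  by apply: mS => //; exact: measurable_set1.
- apply: measurable_funX; apply: measurable_funB;
    apply: measurable_sum_cond => i _; apply: measurable_cyl; exists (val i) => //=;
    by rewrite leq_max ltn_ord ?orbT.
Qed.

Let expect_ED l : (\int[P]_w (\1_(E l) w * D l w)%:E <=
  \int[P]_w (c * `|l%:R - K%:R| * \1_(E l) w)%:E)%E.
Proof.
have [LD DV] := psum_incr_var K l.
have LE : L1 \1_(E l) by exact: integrable_indic.
have LED : L1 (fun w => \1_(E l) w * D l w).
  exact: (indep_rv_integrableM _ _ (@indep_ED l)).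
rewrite -[leLHS]fineK ?integrable_fin_num//.
rewrite -[leRHS]fineK; last by apply: integrable_fin_num => //; exact: L1Z.
rewrite lee_fin -/(Rintegral _ _ _) -/(Rintegral _ _ _) indep_rv_expectM// RintegralZl//.
by rewrite mulrC; apply: ler_wpM2r; [exact: Rintegral_ge0|exact: DV].
Qed.

(** The events [E l] partition the space, so a single term of the series is nonzero. *)
Let sum_indic (u : nat -> R) w : (forall l, 0 <= u l) ->
  (u (N w))%:E = (\sum_(l <oo) (\1_(E l) w * u l)%:E)%E.
Proof.
move=> u0; rewrite (@nneseriesD1 _ _ (N w))//; last first.
  by move=> l _; rewrite lee_fin mulr_ge0.
rewrite indicE mem_set// mul1r eseries0 ?adde0// => l _ lN.
by rewrite indicE memNset ?mul0r// => /eqP; rewrite eq_sym (negbTE lN).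
Qed.

Lemma measurable_psum_index : measurable_fun setT (fun w => psum (N w) w).
Proof. exact: measurable_random_index. Qed.

(* Condition on the value of [N], which is independent of the [Z (inl i)]. *)
Lemma random_index_var : L1 (fun w => (psum (N w) w - psum K w) ^+ 2) /\
  \int[P]_w (psum (N w) w - psum K w) ^+ 2 <= c * \int[P]_w `|(N w)%:R - K%:R|.
Proof.
have LNK : L1 (fun w => `|(N w)%:R - K%:R|).
  by apply: integrable_norm; apply: L1B => //; exact: L1_cst.
(* Stated in the extended reals: sum and integral are exchanged by nonnegativity alone, and the
   integrability of the left side is deduced afterwards from finiteness of the right side. *)
have key : (\int[P]_w ((psum (N w) w - psum K w) ^+ 2)%:E <=
    \int[P]_w (c * `|(N w)%:R - K%:R|)%:E)%E.
  have e1 w : ((psum (N w) w - psum K w) ^+ 2)%:E = (\sum_(l <oo) (\1_(E l) w * D l w)%:E)%E.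
    by rewrite -(@sum_indic (fun l => D l w))// => l; exact: sqr_ge0.
  have e2 w : (c * `|(N w)%:R - K%:R|)%:E =
      (\sum_(l <oo) (\1_(E l) w * (c * `|l%:R - K%:R|))%:E)%E.
    by rewrite -(@sum_indic (fun l => c * `|l%:R - K%:R|))// => l; rewrite mulr_ge0.
  rewrite (eq_integral _ _ (fun w _ => e1 w)) [leRHS](eq_integral _ _ (fun w _ => e2 w)).
  rewrite integral_nneseries//; last 2 first.
    by move=> l; apply/measurable_EFinP.
    by move=> l w _; rewrite lee_fin mulr_ge0// sqr_ge0.
  rewrite integral_nneseries//; last 2 first.
    by move=> l; apply/measurable_EFinP; apply: measurable_funM.
    by move=> l w _; rewrite lee_fin mulr_ge0// mulr_ge0.
  apply: lee_nneseries => l _; first move=> _.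
    by apply: integral_ge0 => w _; rewrite lee_fin mulr_ge0// sqr_ge0.
  apply: (le_trans (expect_ED l)); rewrite le_eqVlt; apply/orP; left; apply/eqP.
  by apply: eq_integral => w _; rewrite mulrC.
have mS : measurable_fun setT (fun w => (psum (N w) w - psum K w) ^+ 2).
  by apply: measurable_funX; apply: measurable_funB => //; exact: measurable_psum_index.
have L : L1 (fun w => (psum (N w) w - psum K w) ^+ 2).
  apply/integrableP; split; first exact/measurable_EFinP.
  under eq_integral do rewrite /= ger0_norm ?sqr_ge0//.
  by apply: (le_lt_trans key); apply: integrable_lty => //; exact: L1Z.
split=> //; rewrite -RintegralZl// fine_le ?integrable_fin_num//; exact: L1Z.
Qed.

End random_index.
End block_variance.

(** * The random sum *)

Lemma norm_le_sqr (R : realType) (x : R) : `|x| <= 1 + x ^+ 2.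
Proof.
rewrite -[x ^+ 2]real_normK ?num_real//; set y := `|x|.
by have := sqr_ge0 (y - 1); have := sqr_ge0 y; rewrite sqrrB expr1n mulr1; lra.
Qed.

(** Bounds a first moment by a second one, at the price of a free [e], in place of
    Cauchy-Schwarz. *)
Lemma norm_le_sqr_div (R : realType) (e x : R) : 0 < e -> `|x| <= e + x ^+ 2 / e.
Proof.
move=> e0; have e_neq0 : e != 0 by rewrite gt_eqF.
have -> : e + x ^+ 2 / e = (1 + (x / e) ^+ 2) * e by field.
by rewrite -ler_pdivrMr// (le_trans _ (norm_le_sqr _))// normrM normfV (gtr0_norm e0).
Qed.

Section random_sum_clt.
Context d (T : measurableType d) (R : realType) (P : probability T R).

Local Notation L1 f := (P.-integrable setT (EFin \o f)).
Local Notation L3 f := (L1 (fun w => `|f w| ^+ 3)).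
Notation leb := (@lebesgue_measure R).
Notation phi := (normal_pdf (0 : R) 1).

Variables (Z : nat + nat -> T -> R) (m : nat) (a : nat -> R) (rho mu nu t2 : R).
Hypotheses (mZ : forall s, measurable_fun setT (Z s)) (LZ : forall s, L3 (Z s)).
Hypotheses (Z_rho : forall s, \int[P]_w `|Z s w| ^+ 3 <= rho).
Hypothesis Z0 : forall s, \int[P]_w Z s w = 0.
Hypothesis Z_ind : forall F G, finite_set F -> finite_set G -> m_separated m F G ->
  indep_sets P (cyl Z F) (cyl Z G).
Hypothesis Za : forall i l, \int[P]_w (Z (inl i) w * Z (inl (i + l)%N) w) = a l.
Hypothesis Zt : forall k, \int[P]_w (Z (inr k) w * Z (inr k) w) = t2.
Variable N : nat -> T -> nat.
Hypothesis NZ : forall n w,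
  mu * ((N n w)%:R - n%:R * nu) = \sum_(k < n) Z (inr (val k)) w.
Hypotheses (mu_gt0 : 0 < mu) (nu_gt0 : 0 < nu).

Let s2 := long_run_var m a.
Let V := nu * s2 + t2.
Hypothesis V_gt0 : 0 < V.

Let b n : R := (Num.sqrt (n%:R * V))^-1.
Let K n : nat := Num.truncn (n%:R * nu).
Let Y n w := \sum_(k < n) Z (inr (val k)) w.
Let S n w := psum Z (K n) w.
Let D n w := psum Z (N n w) w - S n w.
Let err := block_var_error P Z m a.
Let c := err + `|s2|.

Let V0 : V != 0. Proof. by rewrite gt_eqF. Qed.

Let err0 : 0 <= err. Proof. exact: block_var_error_ge0. Qed.

Let c0 : 0 <= c. Proof. by rewrite addr_ge0. Qed.

Let t20 : 0 <= t2.
Proof. by rewrite -(Zt 0); apply: Rintegral_ge0 => w _; rewrite -expr2 sqr_ge0. Qed.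

Let b_ge0 n : 0 <= b n. Proof. by rewrite invr_ge0 sqrtr_ge0. Qed.

(* Inverses of [0] are [0], so that [W 0] below is [0]. *)
Let b0 : b 0%N = 0. Proof. by rewrite /b mul0r sqrtr0 invr0. Qed.

Let b_sqr n : b n ^+ 2 = (n%:R * V)^-1.
Proof. by rewrite exprVn sqr_sqrtr// mulr_ge0// ltW. Qed.

Let b_sqr_n n : (0 < n)%N -> b n ^+ 2 * n%:R = V^-1.
Proof.
move=> n0; rewrite b_sqr; field.
by rewrite V0 pnatr_eq0 -lt0n n0.
Qed.

Let b_sqr_n_le n : b n ^+ 2 * n%:R <= V^-1.
Proof.
case: n => [|n]; first by rewrite mulr0 invr_ge0 ltW.
by rewrite b_sqr_n.
Qed.

Let b_le n : b n <= b 1%N.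
Proof.
case: n => [|n]; first by rewrite b0.
have pos k : 0 < Num.sqrt (k.+1%:R * V) by rewrite sqrtr_gt0 mulr_gt0.
rewrite /b lef_pV2 ?posrE// ler_wsqrtr// ler_wpM2r ?ler_nat// ltW//.
Qed.

Let b_gt0 n : (0 < n)%N -> 0 < b n.
Proof. by case: n => // n _; rewrite invr_gt0 sqrtr_gt0 mulr_gt0. Qed.

Let b_small (e : R) : 0 < e -> \forall n \near \oo, b n < e.
Proof.
move=> e0; near=> n.
have n0 : (0 < n)%N by near: n; exact: nbhs_infty_gt.
rewrite -ltr_sqr ?nnegrE//; last exact: ltW.
rewrite b_sqr invf_plt ?posrE ?exprn_gt0 ?mulr_gt0 ?ltr0n//.
rewrite -ltr_pdivrMr//; near: n; exact: nbhs_infty_gtr.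
Unshelve. all: by end_near. Qed.

Let K_itv n : (K n)%:R <= n%:R * nu < (K n)%:R + 1.
Proof.
rewrite natr1; apply: truncn_itv; by rewrite mulr_ge0// ltW.
Qed.

Let LY n : L1 (Y n).
Proof. by apply: L1_sum => k; exact: L3_L1. Qed.

Let NE n w : (N n w)%:R = mu^-1 * Y n w + n%:R * nu.
Proof. by rewrite /Y -NZ mulKf ?subrK// gt_eqF. Qed.

Let LN n : L1 (fun w => (N n w)%:R : R).
Proof.
rewrite (_ : (fun w => (N n w)%:R) = fun w => mu^-1 * Y n w + n%:R * nu).
  by apply: L1D; [exact: L1Z|exact: L1_cst].
by apply/funext => w; exact: NE.
Qed.

Let Ny n w l : N n w = l <-> Y n w = mu * (l%:R - n%:R * nu).
Proof.
rewrite /Y -NZ; split=> [-> //|/(mulfI (lt0r_neq0 mu_gt0))/addIr/eqP].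
by rewrite eqr_nat => /eqP.
Qed.

Let LY2 n : L1 (fun w => Y n w ^+ 2).
Proof. exact: (L1_sum_sqr mZ LZ (fun k : 'I_n => inr (val k))). Qed.

Let expect_Y2 n : \int[P]_w (Y n w ^+ 2) = n%:R * t2.
Proof.
rewrite (expect_sum_sqr mZ LZ (fun k : 'I_n => inr (val k))).
transitivity (\sum_(k < n) t2); last by rewrite sumr_const card_ord mulr_natl.
apply: eq_bigr => k _; rewrite (bigD1 k)//= Zt big1 ?addr0// => l lk.
apply: (expect_separated mZ LZ Z0 Z_ind); split => // k' /= [->] [].
by move=> /val_inj kl; rewrite kl eqxx in lk.
Qed.

Let LS2 n : L1 (fun w => S n w ^+ 2) /\ \int[P]_w (S n w ^+ 2) <= c * (K n)%:R.
Proof.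
have := psum_incr_var mZ LZ Z0 Z_ind Za 0 (K n).
rewrite subr0 normr_nat -/err -/s2 -/c.
rewrite (_ : (fun w => (psum Z (K n) w - psum Z 0 w) ^+ 2) = fun w => S n w ^+ 2)//.
by apply/funext => w; rewrite [psum Z 0 w]/psum big_ord0 subr0.
Qed.

Let LD2 n : L1 (fun w => D n w ^+ 2) /\
  \int[P]_w (D n w ^+ 2) <= c * \int[P]_w `|(N n w)%:R - (K n)%:R|.
Proof. exact: (random_index_var mZ LZ Z0 Z_ind Za _ (Ny n) (LN n)). Qed.

Let mpsumN n : measurable_fun setT (fun w => psum Z (N n w) w).
Proof. exact: (measurable_psum_index mZ (Ny n)). Qed.

Let mS n : measurable_fun setT (S n).
Proof. by apply: measurable_sum_cond. Qed.

Let mD n : measurable_fun setT (D n).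
Proof. exact: measurable_funB. Qed.

Let alpha := (t2 / V + 1) / mu + b 1%N.

(** The difference [N n - K n] is [Y n / mu] plus a rounding error below [1]. Since
    [|y| <= b * y^2 + 1 / b] and [Y n] has second moment [n * t2], its mean modulus is of order
    [1 / b], that is [sqrt n]. Multiplying by [b ^ 2], with [b ^ 2 * n = 1 / V] and [b n <= b 1],
    produces [alpha]. *)
Let expect_NK n : (0 < n)%N ->
  b n ^+ 2 * \int[P]_w `|(N n w)%:R - (K n)%:R| <= alpha * b n.
Proof.
move=> n0; have bn := b_gt0 n0.
have pt w : `|(N n w)%:R - (K n)%:R| <= mu^-1 * (b n * Y n w ^+ 2 + (b n)^-1) + 1.
  have -> : (N n w)%:R - (K n)%:R = mu^-1 * Y n w + (n%:R * nu - (K n)%:R).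
    by rewrite NE addrA.
  rewrite (le_trans (ler_normD _ _))// lerD//; last first.
    by have /andP[h1 h2] := K_itv n; rewrite ger0_norm; lra.
  rewrite normrM (gtr0_norm (x := mu^-1)) ?invr_gt0// ler_wpM2l ?invr_ge0 ?(ltW mu_gt0)//.
  (* if [y > 1 / b] then [y <= b * y ^ 2] *)
  rewrite -[Y n w ^+ 2]real_normK ?num_real//; set y := `|_|.
  have y0 : 0 <= y by exact: normr_ge0.
  have [h|h] := leP y (b n)^-1.
    by rewrite (le_trans h)// lerDr mulr_ge0// sqr_ge0.
  apply: (@le_trans _ _ (b n * y ^+ 2)); last by rewrite lerDl invr_ge0.
  by rewrite expr2 mulrA ler_peMl// mulrC -ler_pdivrMr// div1r ltW.
apply: (@le_trans _ _ (b n ^+ 2 * (mu^-1 * (b n * (n%:R * t2) + (b n)^-1) + 1))).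
  rewrite ler_wpM2l ?sqr_ge0//.
  have LbY : L1 (fun w => b n * Y n w ^+ 2) by exact: L1Z.
  have LbYc : L1 (fun w => b n * Y n w ^+ 2 + (b n)^-1).
    by apply: L1D => //; exact: L1_cst.
  have LmbYc : L1 (fun w => mu^-1 * (b n * Y n w ^+ 2 + (b n)^-1)) by exact: L1Z.
  have <- : \int[P]_w (mu^-1 * (b n * Y n w ^+ 2 + (b n)^-1) + 1) =
      mu^-1 * (b n * (n%:R * t2) + (b n)^-1) + 1.
    rewrite RintegralD//; last exact: L1_cst.
    rewrite expect_cst RintegralZl// RintegralD//; last exact: L1_cst.
    by rewrite expect_cst RintegralZl// expect_Y2.
  apply: le_expect => //.
    by apply: integrable_norm; apply: L1B => //; exact: L1_cst.
  by apply: L1D => //; exact: L1_cst.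
have -> : b n ^+ 2 * (mu^-1 * (b n * (n%:R * t2) + (b n)^-1) + 1) =
   ((b n ^+ 2 * n%:R) * t2 + 1) / mu * b n + b n * b n.
  by field; rewrite !gt_eqF.
rewrite b_sqr_n// /alpha [leRHS]mulrDl lerD//; first by rewrite (mulrC V^-1).
by rewrite ler_wpM2r.
Qed.

Let bound_D n : b n ^+ 2 * \int[P]_w (D n w ^+ 2) <= c * alpha * b n.
Proof.
case: n => [|n]; first by rewrite b0 expr0n/= mul0r mulr0.
have [_ h] := LD2 n.+1.
apply: (@le_trans _ _ (b n.+1 ^+ 2 * (c * \int[P]_w `|(N n.+1 w)%:R - (K n.+1)%:R|))).
  by rewrite ler_wpM2l// sqr_ge0.
rewrite mulrCA -mulrA ler_wpM2l//; exact: expect_NK.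
Qed.

Let bound_S n : b n ^+ 2 * \int[P]_w (S n w ^+ 2) <= c * nu / V.
Proof.
have [_ h] := LS2 n; have /andP[hK _] := K_itv n.
apply: (@le_trans _ _ (b n ^+ 2 * (c * (n%:R * nu)))).
  by rewrite ler_wpM2l ?sqr_ge0// (le_trans h)// ler_wpM2l.
have -> : b n ^+ 2 * (c * (n%:R * nu)) = (c * nu) * (b n ^+ 2 * n%:R) by ring.
by rewrite ler_wpM2l// mulr_ge0// ltW.
Qed.

Let bound_Y n : b n ^+ 2 * \int[P]_w (Y n w ^+ 2) <= t2 / V.
Proof. by rewrite expect_Y2 mulrA mulrC ler_wpM2l. Qed.

(** Splits the random sum minus [n * mu * nu] into the centred sum up to [N n] and
    [mu * (N n - n * nu)], the latter being [Y n]. *)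
Let W n w := (psum Z (N n w) w + Y n w) / Num.sqrt (n%:R * V).

Let WE n w : W n w = b n * D n w + b n * S n w + b n * Y n w.
Proof. by rewrite /W -/(b n) /D; ring. Qed.

Let mY n : measurable_fun setT (Y n). Proof. exact: L1_measurable. Qed.

Let mW n : measurable_fun setT (W n).
Proof. by apply: measurable_funM => //; exact: measurable_funD. Qed.

Let q n w := b n ^+ 2 * D n w ^+ 2 + b n ^+ 2 * S n w ^+ 2 + b n ^+ 2 * Y n w ^+ 2.

Let Lq n : L1 (q n).
Proof.
have [LD _] := LD2 n; have [LS _] := LS2 n.
by apply: L1D; [apply: L1D|]; exact: L1Z.
Qed.

Let Wq n w : `|W n w| <= 3 + q n w.
Proof.
rewrite WE (le_trans (ler_normD _ _))//.
have := ler_normD (b n * D n w) (b n * S n w).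
have := norm_le_sqr (b n * D n w); have := norm_le_sqr (b n * S n w).
by have := norm_le_sqr (b n * Y n w); rewrite !exprMn /q; lra.
Qed.

Let L3q n : L1 (fun w => 3 + q n w).
Proof. by apply: L1D => //; exact: L1_cst. Qed.

Let LW n : L1 (W n).
Proof. exact: (L1_dominated (mW n) (Wq n) (L3q n)). Qed.

Let alpha0 : 0 <= alpha.
Proof. by rewrite addr_ge0// divr_ge0 ?(ltW mu_gt0)// addr_ge0// divr_ge0// ltW. Qed.

Let expect_W n : \int[P]_w `|W n w| <= 3 + (c * alpha * b 1%N + c * nu / V + t2 / V).
Proof.
have [LD _] := LD2 n; have [LS _] := LS2 n.
apply: (@le_trans _ _ (\int[P]_w (3 + q n w))).
  by apply: le_expect => //; exact: integrable_norm.
rewrite RintegralD//; last exact: L1_cst.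
rewrite expect_cst lerD2l /q RintegralD//; [|by apply: L1D; exact: L1Z|exact: L1Z].
rewrite RintegralD//; [|exact: L1Z|exact: L1Z].
rewrite !RintegralZl// !lerD//; apply: (le_trans (bound_D n)).
by rewrite ler_wpM2l// mulr_ge0.
Qed.

Let U n w := b n * (\sum_(i < K n) Z (inl (val i)) w + \sum_(k < n) Z (inr (val k)) w).

Let mU n : measurable_fun setT (U n).
Proof. by apply: measurable_funM => //; apply: measurable_funD; [exact: mS|exact: mY]. Qed.

(** [W n - U n] is [b n * D n], whose mean square is of order [b n]. The parameter [e] is fixed
    before [n] tends to infinity. *)
Let expect_WU (g : R -> R) (Lg e : R) n : 0 < e ->
  (forall x y, `|g x - g y| <= Lg * `|x - y|) -> (exists M, forall x, `|g x| <= M) ->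
  `|\int[P]_w g (W n w) - \int[P]_w g (U n w)| <= `|Lg| * (e + c * alpha * b n / e).
Proof.
move=> e0 gL [M gM]; have [LD _] := LD2 n.
have mg := lipschitz_measurable gL.
have LgW : L1 (fun w => g (W n w)).
  by apply: (@L1_bounded _ _ _ _ _ M) => //; exact: measurableT_comp.
have LgU : L1 (fun w => g (U n w)).
  by apply: (@L1_bounded _ _ _ _ _ M) => //; exact: measurableT_comp.
have LbD : L1 (fun w => b n ^+ 2 / e * D n w ^+ 2) by exact: L1Z.
have Leb : L1 (fun w => e + b n ^+ 2 / e * D n w ^+ 2) by apply: L1D => //; exact: L1_cst.
rewrite -RintegralB//.
apply: (@le_trans _ _ (\int[P]_w (`|Lg| * (e + b n ^+ 2 / e * D n w ^+ 2)))).
  apply: norm_expect_le_bound; [exact: L1B|exact: L1Z|].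
  move=> w; rewrite (le_trans (gL _ _))//.
  have -> : W n w - U n w = b n * D n w by rewrite WE /U /S /psum /Y; ring.
  apply: (@le_trans _ _ (`|Lg| * `|b n * D n w|)).
    by rewrite ler_wpM2r// ler_norm.
  rewrite ler_wpM2l// (le_trans (norm_le_sqr_div _ e0))//.
  by rewrite exprMn mulrAC.
rewrite RintegralZl// ler_wpM2l// RintegralD//; last exact: L1_cst.
rewrite expect_cst lerD2l RintegralZl// mulrAC ler_wpM2r ?invr_ge0 ?(ltW e0)//.
Qed.

Let Cs L := L * (2 * (m + m)).+1%:R ^+ 2 * (6 * rho + (1 + 2 * rho) * (rho + 2)).

(** Writing [1] as [b ^ 2 * n * V], the variance defect becomes [b ^ 2] times the rounding error of
    [K n], weighted by [s2], plus the block error; together these are at most [c]. Both error terms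
    are then of order [b n]. *)
Let expect_stein (f f' : R -> R) (M0 M L : R) n : (0 < n)%N ->
  (forall x : R, is_derive x 1 f (f' x)) -> (forall x, `|f x| <= M0) ->
  (forall x, `|f' x| <= M) -> 0 <= L ->
  (forall x y, `|f' x - f' y| <= L * `|x - y|) ->
  `|\int[P]_w f' (U n w) - \int[P]_w (U n w * f (U n w))| <=
  (M * c * b 1%N + (nu + 1) / V * Cs L) * b n.
Proof.
move=> n0 ff' fM f'M L0 f'L.
have r0 : 0 <= rho.
  apply: le_trans (Z_rho (inl 0%N)); apply: Rintegral_ge0 => w _.
  by rewrite exprn_ge0.
have M1 : 0 <= M by exact: le_trans (f'M 0).
have Cs0 : 0 <= Cs L.
  rewrite /Cs mulr_ge0//; first by rewrite mulr_ge0// sqr_ge0.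
  by rewrite addr_ge0 ?mulr_ge0// ?addr_ge0// mulr_ge0.
have := stein_sum mZ LZ Z_rho Z0 Z_ind (K n) n ff' fM f'M L0 f'L (b_ge0 n).
move=> /le_trans; apply.
rewrite -/(Cs L) mulrDl lerD//.
  rewrite -(mulrA (M * c)) -(mulrA M) ler_wpM2l//.
  have /andP[K1 K2] := K_itv n.
  have -> : \sum_(k < n) \int[P]_w (Z (inr (val k)) w * Z (inr (val k)) w) = n%:R * t2.
    by rewrite (eq_bigr (fun=> t2))// sumr_const card_ord mulr_natl.
  rewrite -/(block_var P Z (K n)).
  rewrite -[X in `|X - _|](mulVf V0) -(b_sqr_n n0) -mulrA -mulrBr normrM ger0_norm ?sqr_ge0//.
  apply: (@le_trans _ _ (b n ^+ 2 * c)); last first.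
    by rewrite mulrC ler_wpM2l// expr2 ler_wpM2r.
  rewrite ler_wpM2l ?sqr_ge0//.
  have -> : n%:R * V - (block_var P Z (K n) + n%:R * t2) =
     (n%:R * nu - (K n)%:R) * s2 - (block_var P Z (K n) - (K n)%:R * s2).
    by rewrite /V; ring.
  rewrite (le_trans (ler_normB _ _))// addrC lerD//.
    exact: (block_var_approx mZ LZ Z0 Z_ind Za).
  rewrite normrM ler_piMl// ger0_norm; lra.
have -> : b n ^+ 3 * (K n + n)%:R * Cs L = b n ^+ 2 * (K n + n)%:R * Cs L * b n by ring.
rewrite ler_wpM2r// ler_wpM2r//.
have /andP[K1 _] := K_itv n.
apply: (@le_trans _ _ (b n ^+ 2 * (n%:R * (nu + 1)))).
  by rewrite ler_wpM2l ?sqr_ge0// natrD mulrDr mulr1 lerD2r.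
by rewrite mulrA b_sqr_n// mulrC.
Qed.

Theorem random_sum_clt : cvg_dist_std_normal P W.
Proof.
apply: (cvg_dist_std_normal_of_stein mW LW expect_W) => g Lg A A0 gA gL g0.
have [f [f' [M0 [M [L [ff' fM f'M [L0 f'L] fg]]]]]] := stein_equation A0 gA gL g0.
have mf : measurable_fun setT f := lipschitz_measurable (derive_bounded_lipschitz ff' f'M).
have mf' := lipschitz_measurable f'L.
have gb : exists M, forall x, `|g x| <= M.
  exists (`|Lg| * (2 * A)) => x.
  have [xA|xA] := leP A `|x|; first by rewrite gA// normr0 !mulr_ge0// ltW.
  rewrite -(subr0 (g x)) -(gA A); last by rewrite gtr0_norm.
  rewrite (le_trans (gL _ _))// (le_trans (ler_wpM2r _ (ler_norm Lg)))//.
  rewrite ler_wpM2l// (le_trans (ler_normB _ _))// (gtr0_norm A0).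
  by move/ltW : xA; lra.
apply/cvgrPdist_le => e e0.
(* Half of [e] pays for the part of the replacement error that does not decay with [n]; the summand
   [1] avoids dividing by zero. [Q] collects all coefficients of [b n], and [eta] makes their
   contribution at most the other half. *)
pose e1 := e / 2 / (`|Lg| + 1).
have Lg1 : 0 < `|Lg| + 1 by rewrite ltr_pwDr.
have e10 : 0 < e1 by rewrite !divr_gt0.
pose Q := `|Lg| * (c * alpha / e1) + (M * c * b 1%N + (nu + 1) / V * Cs L).
pose eta := e / 2 / (`|Q| + 1).
have Q1 : 0 < `|Q| + 1 by rewrite ltr_pwDr.
have eta0 : 0 < eta by rewrite !divr_gt0.
near=> n.
have n0 : (0 < n)%N by near: n; exact: nbhs_infty_gt.
have bn : b n < eta by near: n; exact: b_small.
have LUf : L1 (fun w => U n w * f (U n w)).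
  apply: (@L1_mulr_bounded _ _ _ _ _ _ M0) => //; last exact: measurableT_comp.
  by apply: L1Z; apply: L1D; apply: L1_sum => s; exact: L3_L1.
have Lf' : L1 (fun w => f' (U n w)).
  by apply: (@L1_bounded _ _ _ _ _ M) => //; exact: measurableT_comp.
have gU : \int[P]_w g (U n w) = \int[P]_w f' (U n w) - \int[P]_w (U n w * f (U n w)).
  by rewrite -RintegralB//; apply: eq_Rintegral => w _; rewrite fg.
have h1 := expect_WU n e10 gL gb.
have h2 := expect_stein n0 ff' fM f'M L0 f'L; rewrite -gU in h2.
rewrite sub0r normrN -(subrK (\int[P]_w g (U n w)) (\int[P]_w g (W n w))).
rewrite (le_trans (ler_normD _ _))// (le_trans (lerD h1 h2))//.
have -> : `|Lg| * (e1 + c * alpha * b n / e1) + (M * c * b 1%N + (nu + 1) / V * Cs L) * b n =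
  `|Lg| * e1 + Q * b n by rewrite /Q; ring.
have h3 : `|Lg| * e1 <= e / 2.
  rewrite /e1 mulrCA ler_piMr//; first by rewrite divr_ge0// ltW.
  by rewrite ler_pdivrMr// mul1r lerDl.
have h4 : Q * b n <= e / 2.
  apply: (@le_trans _ _ (`|Q| * eta)).
    by apply: (le_trans (ler_norm _)); rewrite normrM ler_pM// ger0_norm// ltW.
  rewrite /eta mulrCA ler_piMr//; first by rewrite divr_ge0// ltW.
  by rewrite ler_pdivrMr// mul1r lerDl.
lra.
Unshelve. all: by end_near. Qed.

End random_sum_clt.

(** * Transfer of expectations between equal laws *)

Section same_law.
Context d (T : measurableType d) (R : realType) (P : probability T R).
Local Notation L1 f := (P.-integrable setT (EFin \o f)).
Local Notation L3 f := (L1 (fun w => `|f w| ^+ 3)).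

Lemma same_law_expect d' (U : measurableType d') (F G : T -> U) (u : U -> R) :
  measurable_fun setT F -> measurable_fun setT G -> measurable_fun setT u ->
  (forall E, measurable E -> P (F @^-1` E) = P (G @^-1` E)) ->
  L1 (u \o F) -> L1 (u \o G) /\ \int[P]_w u (F w) = \int[P]_w u (G w).
Proof.
move=> mF mG mu FG Lu.
pose Fm : {mfun T >-> U} := mfun_pack mF.
pose Gm : {mfun T >-> U} := mfun_pack mG.
have mEu : measurable_fun setT (EFin \o u) by exact/measurable_EFinP.
have LuG : L1 (u \o G).
  apply/integrableP; split; first by apply/measurable_EFinP; exact: measurableT_comp.
  case/integrableP : Lu => _; apply: le_lt_trans.
  have ge0 (Hm : {mfun T >-> U}) : (\int[P]_w `|(EFin \o (u \o Hm)) w| =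
      \int[distribution P Hm]_x `|(EFin \o u) x|)%E.
    by rewrite ge0_integral_distribution//; exact: measurableT_comp.
  rewrite (ge0 Fm) (ge0 Gm) le_eqVlt; apply/orP; left; apply/eqP.
  by apply: eq_measure_integral => E mE _; exact/esym/FG.
split => //; congr fine.
transitivity (\int[distribution P Fm]_x (u x)%:E)%E.
  by rewrite integral_distribution.
transitivity (\int[distribution P Gm]_x (u x)%:E)%E; last by rewrite integral_distribution.
by apply: eq_measure_integral => E mE _; exact: FG.
Qed.

Lemma same_law_pair (F1 F2 G1 G2 : T -> R) :
  measurable_fun setT F1 -> measurable_fun setT F2 ->
  measurable_fun setT G1 -> measurable_fun setT G2 ->
  (forall C D, measurable C -> measurable D ->
    P (F1 @^-1` C `&` F2 @^-1` D) = P (G1 @^-1` C `&` G2 @^-1` D)) ->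
  forall E : set (R * R), measurable E ->
    P ((fun w => (F1 w, F2 w)) @^-1` E) = P ((fun w => (G1 w, G2 w)) @^-1` E).
Proof.
move=> mF1 mF2 mG1 mG2 FG E mE.
have mF : measurable_fun setT (fun w => (F1 w, F2 w)) by exact: measurable_fun_pair.
have mG : measurable_fun setT (fun w => (G1 w, G2 w)) by exact: measurable_fun_pair.
pose Fm : {mfun T >-> (R * R)%type} := mfun_pack mF.
pose Gm : {mfun T >-> (R * R)%type} := mfun_pack mG.
pose rect : set (set (R * R)) := [set A `*` B | A in measurable & B in measurable].
apply: (@measure_unique _ R _ rect (fun=> setT) _ _ _ _
  (distribution P Fm) (distribution P Gm)) => //.
- exact: measurable_prod_measurableType.
- move=> _ _ [A mA [B mB <-]] [A' mA' [B' mB' <-]]; rewrite -setXI.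
  by exists (A `&` A'); [exact: measurableI|exists (B `&` B') => //; exact: measurableI].
- by move=> _; exists setT => //; exists setT => //; rewrite setXTT.
- by rewrite bigcup_const.
- by move=> _ [A mA [B mB <-]]; exact: FG.
- by move=> _; rewrite /= (le_lt_trans (probability_le1 _ _))// ltry.
Qed.

Lemma L3Z (k : R) (f : T -> R) : L3 f -> L3 (fun w => k * f w).
Proof.
move=> Lf; rewrite (_ : (fun w => `|k * f w| ^+ 3) = fun w => `|k| ^+ 3 * `|f w| ^+ 3).
  exact: L1Z.
by apply/funext => w; rewrite normrM exprMn.
Qed.

Lemma L3B_cst (f : T -> R) (k : R) : measurable_fun setT f -> L3 f -> L3 (fun w => f w - k).
Proof.
move=> mf Lf.
have Lg : L1 (fun w => 8 * (`|f w| ^+ 3 + `|k| ^+ 3)).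
  by apply: L1Z; apply: L1D => //; exact: L1_cst.
apply: L1_dominated Lg.
  apply: measurable_funX; apply: measurableT_comp => //; exact: measurable_funB.
move=> w; rewrite normrX normr_id.
set x := `|f w|; set y := `|k|.
have [x0 y0] : 0 <= x /\ 0 <= y by split; exact: normr_ge0.
apply: (@le_trans _ _ ((x + y) ^+ 3)).
  by rewrite ler_pXn2r ?nnegrE ?addr_ge0// ler_normB.
have h : (x + y) ^+ 3 <= (2 * Num.max x y) ^+ 3.
  have m0 : 0 <= 2 * Num.max x y by rewrite mulr_ge0// le_max x0.
  by rewrite ler_pXn2r ?nnegrE ?addr_ge0//; case: (leP x y); lra.
apply: (le_trans h); rewrite exprMn (_ : 2 ^+ 3 = 8); last by ring.
have [x3 y3] : 0 <= x ^+ 3 /\ 0 <= y ^+ 3 by rewrite !exprn_ge0.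
by rewrite ler_wpM2l//; case: (leP x y); rewrite ?lerDl ?lerDr.
Qed.

Lemma stationary_pair (X : nat -> T -> R) i j s (C D : set R) : stationary P X ->
  measurable C -> measurable D ->
  P (X (i + s)%N @^-1` C `&` X (j + s)%N @^-1` D) = P (X i @^-1` C `&` X j @^-1` D).
Proof.
move=> Xs mC mD.
pose idx l := if l == 0%N then i else j; pose E l := if l == 0%N then C else D.
have two (F : nat -> set T) : \bigcap_(l in `I_2) F l = F 0%N `&` F 1%N.
  apply/seteqP; split=> [w Fw|w [F0 F1] [|[|//]]//].
  by split; exact: Fw.
have mE l : measurable (E l) by rewrite /E; case: ifP.
by have := Xs 2%N s idx E mE; rewrite !two.
Qed.

End same_law.

(* Indexing is 0-based: X_i of the paper is X (i-1), Y_i is Y (i-1). *)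
Theorem theorem2p3 (d : measure_display) (T : measurableType d) (R : realType)
  (P : probability T R) (m : nat) (X : nat -> T -> R) (Y : nat -> T -> nat)
  (mu sigma2 nu tau2 : R) (a : nat -> R) :
  (forall i, measurable_fun setT (X i)) ->
  (forall i, measurable_fun setT (Y i)) ->
  (forall i w, 0 <= X i w) ->
  stationary P X ->
  m_dependent P m X ->
  ('E_P[X 0%N] = mu%:E)%E -> 0 < mu ->
  ('V_P[X 0%N] = sigma2%:E)%E -> 0 < sigma2 ->
  ('E_P[(fun w => `|X 0%N w| ^+ 3)%R] < +oo)%E ->
  (forall j, (1 <= j <= m)%N -> covariance P (X 0%N) (X j) = (a j)%:E) ->
  0 < sigma2 + 2 * \sum_(1 <= j < m.+1) a j ->
  mutually_indep P Y -> ident_distr P Y ->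
  ('E_P[(fun w => (Y 0%N w)%:R : R)%R] = nu%:E)%E -> 0 < nu ->
  ('V_P[(fun w => (Y 0%N w)%:R : R)%R] = tau2%:E)%E -> 0 < tau2 ->
  ('E_P[(fun w => ((Y 0%N w)%:R : R) ^+ 3)%R] < +oo)%E ->
  indep_families P X setT Y setT ->
  cvg_dist_std_normal P
    (fun n w =>
       (\sum_(i < \sum_(k < n) Y k w) X i w - n%:R * mu * nu) /
       Num.sqrt (n%:R * (nu * sigma2 + 2 * nu * \sum_(1 <= j < m.+1) a j
                         + tau2 * mu ^+ 2))).
Proof.
move=> mX mY X_ge0 Xs Xm EX mu0 VX sigma20 X3 covX s20 Yi Yd EY nu0 VY tau20 Y3 XY.
(* The factor [mu] in [v] makes the sum of the [v (Y k)] equal to [mu * (N n - n * nu)], the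
   contribution of the random index. *)
pose u (x : R) := x - mu; pose v (k : nat) : R := mu * (k%:R - nu).
pose Z := mixed X Y u v.
have mu_ : measurable_fun setT u by exact: measurable_funB.
have discrete (f : nat -> R) : measurable_fun setT f by [].
have mZ s : measurable_fun setT (Z s).
  case: s => [i|k]; first exact: measurableT_comp mu_ (mX i).
  exact: measurableT_comp (discrete v) (mY k).
have Z_ind F G : finite_set F -> finite_set G -> m_separated m F G ->
    indep_sets P (cyl Z F) (cyl Z G).
  by move=> fF fG [FGl FGr]; apply: (@indep_sets_mixed _ _ _ _ X Y m u v) => //.
have mY0 : measurable_fun setT (fun w => (Y 0%N w)%:R : R).
  exact: measurableT_comp (discrete (fun k => k%:R)) (mY 0%N).
have L3X0 : P.-integrable setT (EFin \o (fun w => `|X 0%N w| ^+ 3)).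
  apply/integrableP; split.
    by apply/measurable_EFinP; apply: measurable_funX; exact: measurableT_comp.
  move: X3; rewrite unlock; apply: le_lt_trans; rewrite le_eqVlt; apply/orP; left.
  by apply/eqP; apply: eq_integral => w _ /=; rewrite normrX normr_id.
have L3Y0 : P.-integrable setT (EFin \o (fun w => `|(Y 0%N w)%:R : R| ^+ 3)).
  apply/integrableP; split.
    by apply/measurable_EFinP; apply: measurable_funX; exact: measurableT_comp.
  move: Y3; rewrite unlock; apply: le_lt_trans; rewrite le_eqVlt; apply/orP; left.
  by apply/eqP; apply: eq_integral => w _ /=; rewrite normrX normr_id normr_nat.
have lawX2 i j s E : measurable E -> P ((fun w => (X (i + s)%N w, X (j + s)%N w)) @^-1` E) =
    P ((fun w => (X i w, X j w)) @^-1` E).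
  by apply: same_law_pair => // C D mC mD; exact: stationary_pair.
have lawX i C : measurable C -> P (X i @^-1` C) = P (X 0%N @^-1` C).
  by move=> mC; have := stationary_pair 0 0 i Xs mC mC; rewrite !setIid.
(* Every member of the family has the law of [Z (inl 0)] or of [Z (inr 0)], so moments need to be
   computed for these two only. *)
have lawZ s (f : R -> R) : measurable_fun setT f ->
    let t := if s is inl _ then inl 0%N else inr 0%N in
    P.-integrable setT (EFin \o (f \o Z t)) ->
    P.-integrable setT (EFin \o (f \o Z s)) /\ \int[P]_w f (Z s w) = \int[P]_w f (Z t w).
  case: s => [i|k] mf /= Lf.
    have := @same_law_expect _ _ _ P _ _ (X 0%N) (X i) (f \o u) (mX _) (mX _)
      (measurableT_comp mf mu_) (fun C mC => esym (lawX i C mC)) Lf.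
    by move=> [L e]; split => //; exact/esym/e.
  have := @same_law_expect _ _ _ P _ _ (Y 0%N) (Y k) (f \o v) (mY _) (mY _)
    (measurableT_comp mf (discrete v)) (fun C mC => esym (Yd k C mC)) Lf.
  by move=> [L e]; split => //; exact/esym/e.
have mcube : measurable_fun setT (fun x : R => `|x| ^+ 3).
  by apply: measurable_funX; exact: normr_measurable.
have L3Zl : P.-integrable setT (EFin \o (fun w => `|Z (inl 0%N) w| ^+ 3)).
  exact: L3B_cst.
have L3Zr : P.-integrable setT (EFin \o (fun w => `|Z (inr 0%N) w| ^+ 3)).
  by apply: L3Z; exact: L3B_cst.
have Lbase (s : nat + nat) : P.-integrable setT (EFin \o ((fun x : R => `|x| ^+ 3) \o
    Z (if s is inl _ then inl 0%N else inr 0%N))).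
  by case: s => _; [exact: L3Zl|exact: L3Zr].
have LZ s : P.-integrable setT (EFin \o (fun w => `|Z s w| ^+ 3)).
  by case: (lawZ s _ mcube (Lbase s)).
pose rho := \int[P]_w `|Z (inl 0%N) w| ^+ 3 + \int[P]_w `|Z (inr 0%N) w| ^+ 3.
have Z_rho s : \int[P]_w `|Z s w| ^+ 3 <= rho.
  have ge0 t : 0 <= \int[P]_w `|Z t w| ^+ 3.
    by apply: Rintegral_ge0 => w _; rewrite exprn_ge0.
  have [_ ->] := lawZ s _ mcube (Lbase s).
  by case: s => _; rewrite /rho ?lerDl ?lerDr.
have LX0 : P.-integrable setT (EFin \o X 0%N) by exact: L3_L1.
have LY0 : P.-integrable setT (EFin \o (fun w => (Y 0%N w)%:R : R)) by exact: L3_L1.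
have EX0 : \int[P]_w X 0%N w = mu by rewrite /Rintegral; move: EX; rewrite unlock => ->.
have EY0 : \int[P]_w (Y 0%N w)%:R = nu by rewrite /Rintegral; move: EY; rewrite unlock => ->.
have Z0 s : \int[P]_w Z s w = 0.
  have L1s : P.-integrable setT (EFin \o (id \o
      Z (if s is inl _ then inl 0%N else inr 0%N))).
    exact: (L3_L1 (mZ _) (LZ _)).
  have [_ ->] := lawZ s id (@measurable_id _ _ _) L1s.
  case: {L1s} s => _ /=.
    rewrite RintegralB//; last exact: L1_cst.
    by rewrite EX0 expect_cst subrr.
  rewrite RintegralZl//; last by apply: L1B => //; exact: L1_cst.
  rewrite RintegralB//; last exact: L1_cst.
  by rewrite EY0 expect_cst subrr mulr0.
(* [a] is prescribed only at lags from [1] to [m]; the variance computation needs every lag, with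
   the variance at lag [0] and zero beyond [m]. *)
pose a' l := \int[P]_w (Z (inl 0%N) w * Z (inl l) w).
have Za i l : \int[P]_w (Z (inl i) w * Z (inl (i + l)%N) w) = a' l.
  pose f (z : R * R) := u z.1 * u z.2.
  have mf : measurable_fun setT f.
    by apply: measurable_funM; apply: measurableT_comp.
  have := @same_law_expect _ _ _ P _ _ (fun w => (X 0%N w, X l w))
     (fun w => (X i w, X (i + l)%N w)) f (measurable_fun_pair (mX _) (mX _)) (measurable_fun_pair (mX _) (mX _)) mf.
  case=> [E mE| |_ e]; last exact: (esym e).
    by have := lawX2 0 l i E mE; rewrite add0n (addnC l) => ->.
  exact: (L3_mul (mZ (inl 0%N)) (mZ (inl l)) (LZ _) (LZ _)).
have LXj j : P.-integrable setT (EFin \o X j).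
  rewrite (_ : X j = fun w => Z (inl j) w + mu).
    by apply: L1D; [exact: L3_L1|exact: L1_cst].
  by apply/funext => w; rewrite /Z /= /u subrK.
have fineX j : fine 'E_P[X j] = mu.
  rewrite unlock -/(Rintegral P setT (X j)).
  have := Z0 (inl j); rewrite /Z /= /u RintegralB//; last exact: L1_cst.
  by rewrite expect_cst => /eqP; rewrite subr_eq0 => /eqP.
have covE j : a' j = fine (covariance P (X 0%N) (X j)).
  rewrite unlock !fineX unlock; congr fine.
have a'0 : a' 0%N = sigma2 by rewrite covE -/('V_P[X 0%N])%E VX.
have a'j j : (1 <= j <= m)%N -> a' j = a j by move=> jm; rewrite covE covX.
have Zt k : \int[P]_w (Z (inr k) w * Z (inr k) w) = mu ^+ 2 * tau2.
  have L2 : P.-integrable setT (EFin \o ((fun x : R => x * x) \o Z (inr 0%N))) by exact: L3_mul.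
  have mid : measurable_fun setT (@id R) by exact: measurable_id.
  have [_ ->] := lawZ (inr k) (fun x => x * x) (measurable_funM mid mid) L2.
  have LYc : P.-integrable setT (EFin \o (fun w => ((Y 0%N w)%:R - nu) * ((Y 0%N w)%:R - nu))).
    have mYc : measurable_fun setT (fun w => (Y 0%N w)%:R - nu) by exact: measurable_funB.
    by apply: (L3_mul mYc mYc); exact: L3B_cst.
  transitivity (\int[P]_w (mu ^+ 2 * (((Y 0%N w)%:R - nu) * ((Y 0%N w)%:R - nu)))).
    by apply: eq_Rintegral => w _; rewrite /Z /= /v; ring.
  rewrite RintegralZl//; congr (_ * _).
  have -> : tau2 = fine 'V_P[(fun w => (Y 0%N w)%:R : R)%R] by rewrite VY.
  by rewrite /variance unlock EY unlock.
have lrv : long_run_var m a' = sigma2 + 2 * \sum_(1 <= j < m.+1) a j.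
  rewrite /long_run_var a'0; congr (_ + 2 * _); apply: eq_big_nat => j jm.
  by rewrite a'j.
pose N n w := (\sum_(k < n) Y k w)%N.
have NZ n w : mu * ((N n w)%:R - n%:R * nu) = \sum_(k < n) Z (inr (val k)) w.
  rewrite /N natr_sum -mulr_sumr sumrB sumr_const card_ord -[nu *+ n]mulr_natl.
  by [].
have V0 : 0 < nu * long_run_var m a' + mu ^+ 2 * tau2.
  by rewrite lrv addr_gt0// mulr_gt0// exprn_gt0.
have := random_sum_clt mZ LZ Z_rho Z0 Z_ind Za Zt NZ mu0 nu0 V0.
congr (cvg_dist_std_normal P _); apply/funext => n; apply/funext => w.
congr (_ / Num.sqrt (_ * _)); last by rewrite lrv; ring.
rewrite -NZ /psum sumrB sumr_const card_ord -[mu *+ _]mulr_natl -/(N n w).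
ring.
Qed.
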